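(* Let $E\to M$ be a smooth vector bundle. Let $d_1,d_2\in\Gamma(\mathrm{Der}(E^* ))$ have symbols $X_1,X_2\in\mathfrak X(M)$ and let $\mu_1,\mu_2\in\Gamma(J^1(E^* ))$ correspond to $(\varepsilon_1,\phi_1),(\varepsilon_2,\phi_2)\in\Gamma(E^* )\oplus\Gamma(T^*M\otimes E^* )$. Then the bracket on $\Gamma(\mathrm{Der}(E^* )\oplus J^1(E^* ))$ induced via the isomorphism $\Theta$ from the Courant-Dorfman bracket on linear sections of $TE\oplus T^*E\to E$ is $$[\![(d_1,\mu_1),(d_2,\mu_2)]\!]=\big([d_1,d_2],\ \mathcal L_{d_1}\mu_2-\mathcal L_{d_2}\mu_1+j^1\langle d_2,\mu_1\rangle\big),$$ where $\mathcal L_d\mu=\mathcal L_d(\varepsilon,\phi)=\big(d\varepsilon,(\mathcal L_X\circ\phi^*-\phi^*\circ d^* )^*\big)$ is the $\mathrm{Der}(E^* )$-Lie derivative on $J^1(E^* )$ defined by Chen and Liu, for $d$ a derivation of $E^*$ with symbol $X$ and $\mu=(\varepsilon,\phi)$. Thus the $E^*$-valued Courant algebroid structure on $\mathrm{Der}(E^* )\oplus J^1(E^* )$ given by Chen and Liu (the omni-Lie algebroid) is precisely the one induced, via $\Theta$, from the standard Courant algebroid structure on $TE\oplus T^*E\to E$.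
   Context: Everything is smooth; $q_E\colon E\to M$ is the projection. A derivation of a vector bundle $V\to M$ with symbol $X\in\mathfrak X(M)$ is an $\mathbb R$-linear map $D\colon\Gamma(V)\to\Gamma(V)$ with $D(fv)=fD(v)+X(f)v$; its dual derivation $D^*$ of $V^*$ is given by $\langle D^*\nu,v\rangle=X\langle\nu,v\rangle-\langle\nu,Dv\rangle$. $\mathrm{Der}(E^* )$ is the vector bundle whose sections are the derivations of $E^*$; $[d_1,d_2]$ is the commutator. Jets. $J^1(E^* )$ is the first jet bundle of $E^*$, with $j^1\colon\Gamma(E^* )\to\Gamma(J^1(E^* ))$ the jet prolongation and $\iota\colon\mathrm{Hom}(TM,E^* )\to J^1(E^* )$ the canonical inclusion as the kernel of $\mathrm{pr}_{E^*}\colon J^1(E^* )\to E^*$. There is an $\mathbb R$-linear isomorphism $\Gamma(J^1(E^* ))\cong\Gamma(E^* )\oplus\Gamma(T^*M\otimes E^* )$, $\mu\mapsto(\mathrm{pr}_{E^*}\mu,\mu-j^1(\mathrm{pr}_{E^*}\mu))$; i.e. $(\varepsilon,\phi)$ corresponds to $\mu=j^1\varepsilon+\iota\phi$. Here $\phi\in\Gamma(\mathrm{Hom}(TM,E^* ))$ has dual $\phi^*\colon E\to T^*M$, and for a derivation $d$ of $E^*$ with symbol $X$ one sets $\langle d,\mu\rangle=d\varepsilon+\phi(X)\in\Gamma(E^* )$; $d^*$ is the dual derivation of $E$. Courant algebroid with pairing in a vector bundle $V$ (a $V$-Courant algebroid, or $V$-valued Courant algebroid): a vector bundle $\mathsf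 E\to M$ with anchor $\rho\colon\mathsf E\to TM$, a morphism $\widetilde\rho\colon\mathsf E\to\mathrm{Der}(V)$ such that $\widetilde\rho(e)$ has symbol $\rho(e)$, a nondegenerate symmetric pairing $\mathsf E\times_M\mathsf E\to V$ and an $\mathbb R$-bilinear bracket on $\Gamma(\mathsf E)$ with (1) $[\![e_1,[\![e_2,e_3]\!]]\!]=[\![[\![e_1,e_2]\!],e_3]\!]+[\![e_2,[\![e_1,e_3]\!]]\!]$, (2) $\widetilde\rho(e_1)\langle e_2,e_3\rangle=\langle[\![e_1,e_2]\!],e_3\rangle+\langle e_2,[\![e_1,e_3]\!]\rangle$, (3) $[\![e_1,e_2]\!]+[\![e_2,e_1]\!]=\mathcal D\langle e_1,e_2\rangle$, where $\langle\mathcal Dv,e\rangle=\widetilde\rho(e)(v)$, (4) $\widetilde\rho[\![e_1,e_2]\!]=[\widetilde\rho(e_1),\widetilde\rho(e_2)]$. The omni-Lie algebroid of Chen and Liu is $\mathrm{Der}(E^* )\oplus J^1(E^* )$ with the bracket displayed in the claim, the symmetric $E^*$-valued pairing $\langle(d_1,\mu_1),(d_2,\mu_2)\rangle=\langle d_1,\mu_2\rangle+\langle d_2,\mu_1\rangle$, $\widetilde\rho(d,\mu)=d$ and $\rho(d,\mu)$ the symbol of $d$. Structure on linear sections. Write $\ell_\varepsilon\in C^\infty(E)$ for the linear function $e_m\mapsto\langle\varepsilon(m),e_m\rangle$. For $d$ a derivation of $E^*$ with symbol $X$, let $\widehat{d^*}$ be the (linear) vector field on $E$ with $\widehat{d^*}(\ell_\varepsilon)=\ell_{d\varepsilon}$,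 $\widehat{d^*}(q_E^*f)=q_E^*(X(f))$. For $\psi\in\Gamma(\mathrm{Hom}(E,T^*M))$ let $\widetilde\psi\in\Omega^1(E)$, $\widetilde\psi(e_m)=(T_{e_m}q_E)^*\psi(e_m)$. The linear sections of $TE\oplus T^*E\to E$ are the sections of the form $(\widehat{d^*},\mathbf d\ell_\varepsilon+\widetilde{\phi^*})$; their space is denoted $\Gamma^l_E(TE\oplus T^*E)$, and $\Theta\colon\Gamma(\mathrm{Der}(E^* )\oplus J^1(E^* ))\to\Gamma^l_E(TE\oplus T^*E)$, $\Theta(d,j^1\varepsilon+\iota\phi)=(\widehat{d^*},\mathbf d\ell_\varepsilon+\widetilde{\phi^*})$, is an isomorphism of $C^\infty(M)$-modules. The standard Courant algebroid $TE\oplus T^*E\to E$ has anchor $\mathrm{pr}_{TE}$, pairing $\langle(U,\alpha),(V,\beta)\rangle=\alpha(V)+\beta(U)$ and Courant-Dorfman bracket $[\![(U,\alpha),(V,\beta)]\!]=([U,V],\mathcal L_U\beta-\mathbf i_V\mathbf d\alpha)$ ($U,V\in\mathfrak X(E)$, $\alpha,\beta\in\Omega^1(E)$). Linear sections are closed under this bracket, the pairing of two linear sections is a linear function $\ell_\varepsilon$, identified with $\varepsilon\in\Gamma(E^* )$, and the anchor of a linear section is a linear vector field $\widehat{d^*}$, identified with the derivation $d$ of $E^*$. The structure induced via $\Theta$ on $\mathrm{Der}(E^* )\oplus J^1(E^* )$ is the pullback of these data: $[\![a,b]\!]=\Theta^{-1}[\![\Theta a,\Theta b]\!]$, $\ell_{\langle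 a,b\rangle}=\langle\Theta a,\Theta b\rangle$, and $\widetilde\rho(a)=d$ if $\mathrm{pr}_{TE}(\Theta a)=\widehat{d^*}$. *)

(* Defs.v *)
From HB Require Import structures.
From mathcomp Require Import all_boot all_order all_algebra.
From mathcomp Require Import ring.
From mathcomp Require Import all_classical all_reals all_analysis.
Import Order.TTheory GRing.Theory Num.Theory numFieldNormedType.Exports.

Set Implicit Arguments.
Unset Strict Implicit.
Unset Printing Implicit Defensive.

Local Open Scope classical_set_scope.
Local Open Scope ring_scope.

(* Used for objects specified by a property that determines them uniquely; x0 is
   a default value that plays no role when such an object exists. *)
Definition the (T : Type) (x0 : T) (P : T -> Prop) : T :=
  if pselect (exists x, P x) is left h then projT1 (cid h) else x0.

(* C^k on an open set U: all iterated directional derivatives of order at most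
   k exist and are continuous on U. *)
Fixpoint Ck (R : realType) (n : nat) (W : normedModType R) (k : nat)
    (U : set 'rV[R]_n) (f : 'rV[R]_n -> W) : Prop :=
  (forall x, U x -> {for x, continuous f}) /\
  (if k is k'.+1 then
     forall v, (forall x, U x -> derivable f x v) /\ Ck k' U ('D_v f)
   else True).

Definition smooth_on (R : realType) (n : nat) (W : normedModType R)
    (U : set 'rV[R]_n) (f : 'rV[R]_n -> W) : Prop := forall k, Ck k U f.

Section ck_lemmas.
Variables (R : realType) (n : nat).
Implicit Types (U : set 'rV[R]_n).

Lemma Ck_eq (W : normedModType R) k U (f g : 'rV[R]_n -> W) :
  open U -> (forall x, U x -> f x = g x) -> Ck k U f -> Ck k U g.
Proof.
move=> oU; elim: k f g => [|k IH] f g fg [cf df].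
all: have nfg x : U x -> {near x, f =1 g}
  by move=> Ux; near=> y; apply: fg; near: y; exact: open_nbhs_nbhs.
all: have cg x : U x -> {for x, continuous g}
  by move=> Ux; have cfx : f @ x --> f x := cf x Ux;
    rewrite /prop_for /continuous_at -(fg x Ux);
    apply: cvg_trans cfx; exact: near_eq_cvg (nfg x Ux).
  by [].
split=> // v; have [dfv Cv] := df v; split.
  by move=> x Ux; apply: near_eq_derivable (nfg x Ux) _; exact: dfv.
by apply: IH Cv => x Ux; apply: near_eq_derive; exact: nfg.
Unshelve. all: by end_near. Qed.

Lemma CkS (W : normedModType R) k U (f : 'rV[R]_n -> W) :
  Ck k.+1 U f -> Ck k U f.
Proof.
elim: k f => [|k IH] f /= [cf df]; split=> // v.
by have [dv Cv] := df v; split=> //; apply: IH.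
Qed.

Lemma Ck_cst (W : normedModType R) k U (c : W) : Ck k U (cst c).
Proof.
elim: k c => [|k IH] c /=; split=> //; try by move=> x _; exact: cst_continuous.
move=> v; split; first by move=> x _; exact: derivable_cst.
have -> : 'D_v (cst c : 'rV[R]_n -> W) = cst 0.
  by apply/funext => x; exact: derive_cst.
exact: IH.
Qed.

Lemma CkD (W : normedModType R) k U (f g : 'rV[R]_n -> W) :
  open U -> Ck k U f -> Ck k U g -> Ck k U (f + g).
Proof.
move=> oU; elim: k f g => [|k IH] f g /= [cf df] [cg dg]; split=> //;
  try by move=> x Ux; apply: continuousD; [exact: cf | exact: cg].
move=> v; have [dfv Cf] := df v; have [dgv Cg] := dg v; split.
  by move=> x Ux; apply: derivableD; [exact: dfv | exact: dgv].
apply: (Ck_eq oU _ (IH _ _ Cf Cg)) => x Ux.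
by rewrite deriveD; [ | exact: dfv | exact: dgv].
Qed.

Lemma CkM k U (f g : 'rV[R]_n -> R) :
  open U -> Ck k U f -> Ck k U g -> Ck k U (f * g).
Proof.
move=> oU; elim: k f g => [|k IH] f g Cf Cg.
  case: Cf Cg => [cf _] [cg _]; split=> // x Ux.
  by apply: continuousM; [exact: cf | exact: cg].
have [C1f C1g] := (CkS Cf, CkS Cg).
case: Cf Cg => [cf df] [cg dg]; split.
  by move=> x Ux; apply: continuousM; [exact: cf | exact: cg].
move=> v; have [dfv Df] := df v; have [dgv Dg] := dg v; split.
  by move=> x Ux; apply: derivableM; [exact: dfv | exact: dgv].
apply: (Ck_eq oU _ (CkD oU (IH _ _ C1f Dg) (IH _ _ C1g Df))) => x Ux.
by rewrite deriveM; [ | exact: dfv | exact: dgv].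
Qed.

End ck_lemmas.

Record chart (R : realType) (n : nat) (T : Type) := Chart {
  cdom : set T;
  cimg : set 'rV[R]_n;
  cto : T -> 'rV[R]_n;
  cfrom : 'rV[R]_n -> T;
  cimg_open : open cimg;
  ctoK : forall x, cdom x -> cimg (cto x) /\ cfrom (cto x) = x;
  cfromK : forall y, cimg y -> cdom (cfrom y) /\ cto (cfrom y) = y }.

Definition ccompat (R : realType) n T (c c' : chart R n T) : Prop :=
  let U := cimg c `&` cfrom c @^-1` cdom c' in
  open U /\ smooth_on U (cto c' \o cfrom c).

(* Open sets of the topology induced by a family of charts. *)
Definition mopen (R : realType) n T (A : set (chart R n T)) (O : set T) : Prop :=
  forall c, A c -> open (cimg c `&` cfrom c @^-1` O).

(* An n-dimensional smooth manifold structure (maximal atlas) on the set T. *)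
Record manifold (R : realType) (n : nat) (T : Type) := Manifold {
  atlas : set (chart R n T);
  atlas_cover : forall x, exists2 c, atlas c & cdom c x;
  atlas_compat : forall c c', atlas c -> atlas c' -> ccompat c c';
  atlas_max : forall c,
    (forall c', atlas c' -> ccompat c c' /\ ccompat c' c) -> atlas c;
  mhausdorff : forall x y, x <> y -> exists U V,
    [/\ mopen atlas U, mopen atlas V, U x, V y & U `&` V = set0];
  msecond_countable : exists B : nat -> set T,
    (forall i, mopen atlas (B i)) /\
    (forall U x, mopen atlas U -> U x -> exists2 i, B i x & B i `<=` U) }.

Definition smooth (R : realType) n T (M : manifold R n T) (f : T -> R) : Prop :=
  forall c, atlas M c -> smooth_on (cimg c) (f \o cfrom c).

Section cinf.
Variables (R : realType) (n : nat) (T : Type) (M : manifold R n T).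

Definition smooth_pred : {pred T -> R} := fun f => `[< smooth M f >].

Lemma smooth_subring : subring_closed smooth_pred.
Proof.
have smD f g : smooth M f -> smooth M g -> smooth M (f + g).
  by move=> sf sg c Ac k; apply: CkD (sf c Ac k) (sg c Ac k); exact: cimg_open.
have smM f g : smooth M f -> smooth M g -> smooth M (f * g).
  by move=> sf sg c Ac k; apply: CkM (sf c Ac k) (sg c Ac k); exact: cimg_open.
have smC (a : R) : smooth M (cst a) by move=> c Ac k; exact: Ck_cst.
split.
- by apply/asboolP; exact: smC.
- move=> f g /asboolP sf /asboolP sg; apply/asboolP.
  have -> : f - g = f + cst (-1) * g.
    by apply/funext => x; rewrite /= !fctE mulN1r.
  by apply: smD => //; apply: smM.
- by move=> f g /asboolP sf /asboolP sg; apply/asboolP; exact: smM.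
Qed.

HB.instance Definition _ :=
  GRing.isSubringClosed.Build (T -> R) smooth_pred smooth_subring.

Record Cinf := MkCinf { cinf_fun :> T -> R; _ : smooth_pred cinf_fun }.

HB.instance Definition _ := [isSub for cinf_fun].
HB.instance Definition _ := [Choice of Cinf by <:].
HB.instance Definition _ :=
  GRing.SubChoice_isSubComPzRing.Build _ _ Cinf smooth_subring.

Lemma cinf_smooth (f : Cinf) : smooth_pred f.
Proof. exact: valP f. Qed.

Lemma smooth_cst (a : R) : smooth_pred (cst a).
Proof. by apply/asboolP => c Ac k; exact: Ck_cst. Qed.

Definition Ccst (a : R) : Cinf := MkCinf (smooth_cst a).

End cinf.

Arguments MkCinf {R n T} M cinf_fun _.

Section lhom.
Variables (A : comPzRingType) (U V : lmodType A).

Definition lin_pred : {pred U -> V} := fun f => `[< linear f >].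

Lemma lin_submod : submod_closed lin_pred.
Proof.
split=> [|a f g /asboolP lf /asboolP lg]; apply/asboolP => b u v.
  by change (0 = b *: 0 + 0 :> V); rewrite scaler0 addr0.
change (a *: f (b *: u + v) + g (b *: u + v) =
        b *: (a *: f u + g u) + (a *: f v + g v)).
rewrite lf lg !scalerDr !scalerA (mulrC a b).
by rewrite addrACA.
Qed.

Record lhom := MkLhom { lhom_fun :> U -> V; _ : lin_pred lhom_fun }.

HB.instance Definition _ := [isSub for lhom_fun].
HB.instance Definition _ := [Choice of lhom by <:].
HB.instance Definition _ := GRing.SubChoice_isSubLmodule.Build _ _ _ lhom
  (GRing.submod_closed_semi lin_submod).

Lemma lhom_linear (f : lhom) : linear f.
Proof. by case: f => f /= /asboolP. Qed.

HB.instance Definition _ (f : lhom) :=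
  GRing.isLinear.Build A U V _ (f : U -> V) (lhom_linear f).

End lhom.

Section calculus.
Variables (R : realType) (n : nat) (T : Type) (M : manifold R n T).
Local Notation C := (Cinf M).

Section tangent.
Variable m : T.

Definition tangent_pred : {pred C -> R^o} := fun t =>
  `[< (forall a f g, t (Ccst M a * f + g) = a * t f + t g) /\
      (forall f g, t (f * g) = f m * t g + g m * t f) >].

Lemma tangent_submod : submod_closed tangent_pred.
Proof.
split=> [|a t u /asboolP[tl tL] /asboolP[ul uL]]; apply/asboolP.
  have E f : (0 : C -> R^o) f = 0 by [].
  by split=> [b f g|f g]; rewrite !E ?mulr0 addr0.
have E f : (a *: t + u) f = a * t f + u f by [].
split=> [b f g|f g]; rewrite !E; first by rewrite tl ul; ring.
by rewrite tL uL; ring.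
Qed.

(* T_m M is the space of derivations of C^oo(M) at m. *)
Record tangent := MkTangent { tangent_fun :> C -> R^o;
                              _ : tangent_pred tangent_fun }.

HB.instance Definition _ := [isSub for tangent_fun].
HB.instance Definition _ := [Choice of tangent by <:].
HB.instance Definition _ := GRing.SubChoice_isSubLmodule.Build _ _ _ tangent
  (GRing.submod_closed_semi tangent_submod).

Lemma tangentD (t : tangent) f g : t (f + g) = t f + t g.
Proof.
have Ccst1 : Ccst M 1 = 1 by apply: val_inj.
case: t => t /= /asboolP[tl _].
by have := tl 1 f g; rewrite Ccst1 !mul1r.
Qed.

End tangent.

Definition vfield_pred : {pred C -> C^o} := fun X =>
  `[< (forall a f g, X (Ccst M a * f + g) = Ccst M a * X f + X g) /\
      (forall f g, X (f * g) = f * X g + g * X f) >].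

Lemma vfield_submod : submod_closed vfield_pred.
Proof.
split=> [|a X Y /asboolP[Xl XL] /asboolP[Yl YL]]; apply/asboolP.
  have E f : (0 : C -> C^o) f = 0 by [].
  by split=> [b f g|f g]; rewrite !E ?mulr0 addr0.
have E f : (a *: X + Y) f = a * X f + Y f by [].
split=> [b f g|f g]; rewrite !E; first by rewrite Xl Yl; ring.
by rewrite XL YL; ring.
Qed.

(* X(M) is the C^oo(M)-module of derivations of C^oo(M). *)
Record vfield := MkVfield { vfield_fun :> C -> C^o; _ : vfield_pred vfield_fun }.

HB.instance Definition _ := [isSub for vfield_fun].
HB.instance Definition _ := [Choice of vfield by <:].
HB.instance Definition _ := GRing.SubChoice_isSubLmodule.Build _ _ _ vfield
  (GRing.submod_closed_semi vfield_submod).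

Lemma vfieldP (X : vfield) :
  (forall a f g, X (Ccst M a * f + g) = Ccst M a * X f + X g) /\
  (forall f g, X (f * g) = f * X g + g * X f).
Proof. by case: X => X /= /asboolP. Qed.

Lemma vfieldD (X : vfield) f g : X (f + g) = X f + X g.
Proof.
have Ccst1 : Ccst M 1 = 1 by apply: val_inj.
by have := (vfieldP X).1 1 f g; rewrite Ccst1 !mul1r.
Qed.

Lemma vfield_at_subproof (X : vfield) (m : T) :
  tangent_pred m (fun f => X f m : R^o).
Proof.
by apply/asboolP; split=> *; [rewrite (vfieldP X).1 | rewrite (vfieldP X).2].
Qed.

Definition vfield_at (X : vfield) (m : T) : tangent m :=
  MkTangent (vfield_at_subproof X m).

Lemma vbracket_subproof (X Y : vfield) :
  vfield_pred (fun f => X (Y f) - Y (X f)).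
Proof.
apply/asboolP; split=> [a f g|f g].
  rewrite !(vfieldP _).1; rewrite mulrBr opprD addrACA; done.
rewrite !(vfieldP _).2 !vfieldD !(vfieldP _).2 !mulrBr.
by rewrite !opprD !addrA; ring.
Qed.

Definition vbracket (X Y : vfield) : vfield := MkVfield (vbracket_subproof X Y).

(* Omega^1(M) is the C^oo(M)-dual of X(M). *)
Definition oneform := lhom vfield C^o.

Lemma dform_subproof (f : C) : lin_pred (fun X : vfield => X f : C^o).
Proof. by apply/asboolP => g X Y. Qed.

Definition dform (f : C) : oneform := MkLhom (dform_subproof f).

Lemma vbracketZDr (X Y Z : vfield) (f : C) :
  vbracket X (f *: Y + Z) = f *: vbracket X Y + (X f *: Y + vbracket X Z).
Proof.
apply: val_inj; apply/funext => g.
change (X (f * Y g + Z g) - (f * Y (X g) + Z (X g)) =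
  f * (X (Y g) - Y (X g)) + (X f * Y g + (X (Z g) - Z (X g)))).
by rewrite vfieldD (vfieldP X).2; ring.
Qed.

Lemma lieform_subproof (X : vfield) (a : oneform) :
  lin_pred (fun Y : vfield => X (a Y) - a (vbracket X Y) : C^o).
Proof.
apply/asboolP => f Y Z; rewrite vbracketZDr !(lhom_linear a).
change (X (f * a Y + a Z) -
    (f * a (vbracket X Y) + (X f * a Y + a (vbracket X Z))) =
  f * (X (a Y) - a (vbracket X Y)) + (X (a Z) - a (vbracket X Z))).
by rewrite vfieldD (vfieldP X).2; ring.
Qed.

Lemma iextd_subproof (X : vfield) (a : oneform) :
  lin_pred (fun Y : vfield => X (a Y) - Y (a X) - a (vbracket X Y) : C^o).
Proof.
apply/asboolP => f Y Z; rewrite vbracketZDr !(lhom_linear a).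
change (X (f * a Y + a Z) - (f * Y (a X) + Z (a X)) -
    (f * a (vbracket X Y) + (X f * a Y + a (vbracket X Z))) =
  f * (X (a Y) - Y (a X) - a (vbracket X Y)) +
    (X (a Z) - Z (a X) - a (vbracket X Z))).
by rewrite vfieldD (vfieldP X).2; ring.
Qed.

Definition lieform X a : oneform := MkLhom (lieform_subproof X a).

(* i_X (d a) *)
Definition iextd X a : oneform := MkLhom (iextd_subproof X a).

Definition courant_dorfman (a b : vfield * oneform) : vfield * oneform :=
  (vbracket a.1 b.1, lieform a.1 b.2 - iextd b.1 a.2).

Definition courant_pairing (a b : vfield * oneform) : C :=
  a.2 b.1 + b.2 a.1.

End calculus.

(* A rank r vector bundle over M with fibres fib m and total space the set of
   pairs (m, e). *)
Record vbundle (R : realType) (n r : nat) (T : Type) (M : manifold R n T)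
    (fib : T -> lmodType R) := VBundle {
  total : manifold R (n + r) {m : T & fib m};
  proj_smooth : forall f : Cinf M, smooth total (fun p => f (projT1 p));
  (* local triviality: around every point there are a chart c of M and linear
     isomorphisms tr_m : fib m -> R^r for m in dom c such that
     (m, e) |-> (c m, tr_m e) is a chart of the total space *)
  loc_triv : forall m0 : T,
    exists (c : chart R n T) (tr : forall m, fib m -> 'rV[R]_r)
      (tc : chart R (n + r) {m : T & fib m}),
    [/\ atlas M c, cdom c m0, atlas total tc,
        (forall m, cdom c m -> linear (tr m) /\ bijective (tr m)) &
        cdom tc = [set p | cdom c (projT1 p)] /\
        (forall m e, cdom c m -> cto tc (existT _ m e) =
                                 row_mx (cto c m) (tr m e))] }.

Arguments tangent_pred {R n T} M m _.
Arguments proj_smooth {R n r T M fib} v f.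

Section bundle.
Variables (R : realType) (n r : nat) (T : Type) (M : manifold R n T).
Variables (fib : T -> lmodType R) (E : vbundle r M fib).
Local Notation TE := (total E).
Local Notation pt m e := (existT (fun m => fib m : Type) m e).

Definition pullback (f : Cinf M) : Cinf TE :=
  MkCinf TE (fun p => f (projT1 p)) (asboolT (proj_smooth E f)).

Lemma dq_subproof (p : {m : T & fib m}) (t : tangent TE p) :
  tangent_pred M (projT1 p) (fun f => t (pullback f)).
Proof.
case: t => t /= /asboolP[tl tL]; apply/asboolP; split=> [a f g|f g].
  by rewrite -tl; congr t; exact: val_inj.
have -> : pullback (f * g) = pullback f * pullback g by exact: val_inj.
by rewrite tL.
Qed.

Definition dq (p : {m : T & fib m}) (t : tangent TE p) : tangent M (projT1 p) :=
  MkTangent (dq_subproof t).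

(* A map between manifolds is smooth if and only if it pulls smooth functions
   back to smooth functions; this is the form in which smoothness of
   s : M -> E is required. *)
Record sec := MkSec {
  sec_fun :> forall m, fib m;
  sec_smooth : forall F : Cinf TE, smooth M (fun m => F (pt m (sec_fun m))) }.

Definition dualfib (m : T) : lmodType R := lhom (fib m) R^o.

Definition ell_fun (eps : forall m, dualfib m) (p : {m : T & fib m}) : R :=
  (eps (projT1 p) : lhom _ _) (projT2 p).

(* Sections of the dual of E. Such a section is smooth when the associated
   fibrewise linear function on E is smooth: in a bundle chart (x, v) that
   function is sum_j eps_j(x) v_j with eps_j the components of the section. *)
Record dsec := MkDsec {
  dsec_fun :> forall m, dualfib m;
  dsec_smooth : smooth_pred TE (ell_fun dsec_fun) }.

Definition ell (eps : dsec) : Cinf TE := MkCinf TE _ (dsec_smooth eps).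

Lemma dsecP (eps eta : dsec) : (forall m, eps m = eta m) -> eps = eta.
Proof.
case: eps eta => eps peps [eta peta] /= h.
have e : eps = eta by exact: functional_extensionality_dep.
by subst eta; congr MkDsec; exact: Prop_irrelevance.
Qed.

Lemma dsec0_subproof : smooth_pred TE (ell_fun (fun m => 0)).
Proof. exact: smooth_cst 0. Qed.

Lemma dsecN_subproof (eps : dsec) :
  smooth_pred TE (ell_fun (fun m => - eps m)).
Proof. by have := valP (- ell eps). Qed.

Lemma dsecD_subproof (eps eta : dsec) :
  smooth_pred TE (ell_fun (fun m => eps m + eta m)).
Proof. by have := valP (ell eps + ell eta). Qed.

Lemma dsecZ_subproof (f : Cinf M) (eps : dsec) :
  smooth_pred TE (ell_fun (fun m => f m *: eps m)).
Proof. by have := valP (pullback f * ell eps). Qed.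

Definition dsec0 := MkDsec dsec0_subproof.
Definition dsecN eps := MkDsec (dsecN_subproof eps).
Definition dsecD eps eta := MkDsec (dsecD_subproof eps eta).
Definition dsecZ f eps := MkDsec (dsecZ_subproof f eps).

HB.instance Definition _ := gen_eqMixin dsec.
HB.instance Definition _ := gen_choiceMixin dsec.

Lemma dsec_addA : associative dsecD.
Proof. by move=> x y z; apply: dsecP => m /=; rewrite addrA. Qed.
Lemma dsec_addC : commutative dsecD.
Proof. by move=> x y; apply: dsecP => m /=; rewrite addrC. Qed.
Lemma dsec_add0 : left_id dsec0 dsecD.
Proof. by move=> x; apply: dsecP => m /=; rewrite add0r. Qed.
Lemma dsec_addN : left_inverse dsec0 dsecN dsecD.
Proof. by move=> x; apply: dsecP => m /=; rewrite addNr. Qed.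

HB.instance Definition _ :=
  GRing.isZmodule.Build dsec dsec_addA dsec_addC dsec_add0 dsec_addN.

Lemma dsec_scaleA f g x : dsecZ f (dsecZ g x) = dsecZ (f * g) x.
Proof. by apply: dsecP => m /=; rewrite scalerA. Qed.
Lemma dsec_scale1 : left_id 1 dsecZ.
Proof. by move=> x; apply: dsecP => m /=; rewrite scale1r. Qed.
Lemma dsec_scaleDr : right_distributive dsecZ +%R.
Proof. by move=> f x y; apply: dsecP => m /=; rewrite scalerDr. Qed.
Lemma dsec_scaleDl x : {morph dsecZ^~ x : f g / f + g}.
Proof. by move=> f g; apply: dsecP => m /=; rewrite -scalerDl. Qed.

HB.instance Definition _ := GRing.Zmodule_isLmodule.Build (Cinf M) dsec
  dsec_scaleA dsec_scale1 dsec_scaleDr dsec_scaleDl.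

Definition pairing (eps : dsec) (s : sec) : Cinf M :=
  MkCinf M (fun m => (eps m : lhom _ _) (s m)) (asboolT (sec_smooth s (ell eps))).

(* The symbol is part of the data: it is determined by the operator, except
   when E has rank 0. *)
Record der := MkDer {
  der_fun :> dsec -> dsec;
  symb : vfield M;
  der_lin : forall (a : R) x y,
    der_fun (Ccst M a *: x + y) = Ccst M a *: der_fun x + der_fun y;
  der_leibniz : forall f x, der_fun (f *: x) = f *: der_fun x + symb f *: x }.

Lemma derD (d : der) x y : d (x + y) = d x + d y.
Proof.
have Ccst1 : Ccst M 1 = 1 by apply: val_inj.
by have := der_lin d 1 x y; rewrite Ccst1 !scale1r.
Qed.

Lemma der0_lin (a : R) (x y : dsec) : 0 = Ccst M a *: 0 + 0 :> dsec.
Proof. by rewrite scaler0 addr0. Qed.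
Lemma der0_leibniz (f : Cinf M) (x : dsec) :
  0 = f *: 0 + (0 : vfield M) f *: x :> dsec.
Proof.
rewrite scaler0 add0r; have -> : (0 : vfield M) f = 0 by [].
by rewrite scale0r.
Qed.

Definition der0 : der := @MkDer (fun=> 0) 0 der0_lin der0_leibniz.

Lemma dcomm_lin (d1 d2 : der) (a : R) x y :
  d1 (d2 (Ccst M a *: x + y)) - d2 (d1 (Ccst M a *: x + y)) =
  Ccst M a *: (d1 (d2 x) - d2 (d1 x)) + (d1 (d2 y) - d2 (d1 y)).
Proof. by rewrite !der_lin scalerBr opprD addrACA. Qed.

Lemma dcomm_leibniz (d1 d2 : der) f x :
  d1 (d2 (f *: x)) - d2 (d1 (f *: x)) =
  f *: (d1 (d2 x) - d2 (d1 x)) + vbracket (symb d1) (symb d2) f *: x.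
Proof.
have -> : vbracket (symb d1) (symb d2) f =
  symb d1 (symb d2 f) - symb d2 (symb d1 f) by [].
rewrite !der_leibniz !derD !der_leibniz scalerBr scalerBl.
have aux (V : zmodType) (a a' b c u v : V) :
    a + b + (c + u) - (a' + c + (b + v)) = a - a' + (u - v).
  rewrite (addrC c u) (addrACA a b) (addrC b v) (addrACA a' c) (addrC c b).
  by rewrite (addrC (a' + v)) addrKA opprD addrACA.
exact: aux.
Qed.

Definition dcomm (d1 d2 : der) : der :=
  @MkDer (fun x => d1 (d2 x) - d2 (d1 x)) (vbracket (symb d1) (symb d2))
    (dcomm_lin d1 d2) (dcomm_leibniz d1 d2).

Definition der_dual (d : der) : sec -> sec :=
  the id (fun D => forall nu s,
    pairing nu (D s) = symb d (pairing nu s) - pairing (d nu) s).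

Definition der_hat (d : der) : vfield TE :=
  the 0 (fun U : vfield TE => (forall eps, U (ell eps) = ell (d eps)) /\
                  (forall f, U (pullback f) = pullback (symb d f))).

Definition hom_fun_smooth (phi : forall m, lhom (tangent M m) (dualfib m)) : Prop :=
  forall X : vfield M,
    smooth_pred TE (ell_fun (fun m => phi m (vfield_at X m))).

Record homsec := MkHomsec {
  homsec_fun :> forall m, lhom (tangent M m) (dualfib m);
  homsec_smooth : hom_fun_smooth homsec_fun }.

Definition happ (phi : homsec) (X : vfield M) : dsec :=
  MkDsec (homsec_smooth phi X).

Lemma homsecP (phi psi : homsec) : (forall m, phi m = psi m) -> phi = psi.
Proof.
case: phi psi => phi pphi [psi ppsi] /= h.
have e : phi = psi by exact: functional_extensionality_dep.
by subst psi; congr MkHomsec; exact: Prop_irrelevance.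
Qed.

Lemma homsec0_subproof : hom_fun_smooth (fun m => 0).
Proof. by move=> X; exact: dsec_smooth (0 : dsec). Qed.

Lemma homsecN_subproof (phi : homsec) : hom_fun_smooth (fun m => - phi m).
Proof. by move=> X; exact: dsec_smooth (- happ phi X). Qed.

Lemma homsecD_subproof (phi psi : homsec) :
  hom_fun_smooth (fun m => phi m + psi m).
Proof. by move=> X; exact: dsec_smooth (happ phi X + happ psi X). Qed.

Definition homsec0 := MkHomsec homsec0_subproof.
Definition homsecN phi := MkHomsec (homsecN_subproof phi).
Definition homsecD phi psi := MkHomsec (homsecD_subproof phi psi).

HB.instance Definition _ := gen_eqMixin homsec.
HB.instance Definition _ := gen_choiceMixin homsec.

Lemma homsec_addA : associative homsecD.
Proof. by move=> x y z; apply: homsecP => m /=; rewrite addrA. Qed.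
Lemma homsec_addC : commutative homsecD.
Proof. by move=> x y; apply: homsecP => m /=; rewrite addrC. Qed.
Lemma homsec_add0 : left_id homsec0 homsecD.
Proof. by move=> x; apply: homsecP => m /=; rewrite add0r. Qed.
Lemma homsec_addN : left_inverse homsec0 homsecN homsecD.
Proof. by move=> x; apply: homsecP => m /=; rewrite addNr. Qed.

HB.instance Definition _ :=
  GRing.isZmodule.Build homsec homsec_addA homsec_addC homsec_add0 homsec_addN.

Definition cotangent (m : T) : lmodType R := lhom (tangent M m) R^o.

Lemma hdual_subproof (phi : homsec) m (e : fib m) :
  lin_pred (fun t : tangent M m => (phi m t : lhom _ _) e : R^o).
Proof. by apply/asboolP => a t u; rewrite linearP. Qed.

Definition hdual (phi : homsec) m (e : fib m) : cotangent m :=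
  MkLhom (hdual_subproof phi e).

Definition hdual_sec_fun (phi : homsec) (s : sec) (X : vfield M) : Cinf M :=
  MkCinf M (fun m => (hdual phi (s m) : lhom _ _) (vfield_at X m))
    (cinf_smooth (pairing (happ phi X) s)).

Lemma hdual_sec_subproof (phi : homsec) (s : sec) :
  lin_pred (fun X : vfield M => hdual_sec_fun phi s X : (Cinf M)^o).
Proof.
apply/asboolP => f X Y; apply: val_inj; apply/funext => m /=.
have -> : vfield_at (f *: X + Y) m = f m *: vfield_at X m + vfield_at Y m.
  exact: val_inj.
by rewrite linearP.
Qed.

Definition hdual_sec (phi : homsec) (s : sec) : oneform M :=
  MkLhom (hdual_sec_subproof phi s).

(* (L_X o phi^* - phi^* o d^* )^* with X the symbol of d *)
Definition lie_hom (d : der) (phi : homsec) : homsec :=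
  the 0 (fun psi : homsec => forall s,
    hdual_sec psi s =
    lieform (symb d) (hdual_sec phi s) - hdual_sec phi (der_dual d s)).

Definition tilde (phi : homsec) : oneform TE :=
  the 0 (fun w : oneform TE => forall (U : vfield TE) m (e : fib m),
    w U (pt m e) = (hdual phi e : lhom _ _) (dq (vfield_at U (pt m e)))).

(* The 1-jet at m of a section sigma of the dual of E is recorded as its value
   sigma(m) and its first derivatives t<sigma, s>, for t in T_m M and s a
   section of E: two sections have the same 1-jet at m if and only if these
   agree. The fibre of the jet bundle at m is the subspace of the jet_space
   formed by the (j1_fun sigma m). *)
Definition jet_space (m : T) : zmodType :=
  (dualfib m * (tangent M m -> sec -> R^o))%type.

Definition j1_fun (eps : dsec) (m : T) : jet_space m :=
  (eps m, fun (t : tangent M m) (s : sec) => t (pairing eps s)).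

(* The canonical inclusion maps phi_m to the 1-jet of any section that vanishes
   at m and has derivative phi_m there. *)
Definition iota_fun (phi : homsec) (m : T) : jet_space m :=
  (0, fun (t : tangent M m) (s : sec) => (phi m t : lhom _ _) (s m)).

(* A section of the jet bundle is smooth when it is j^1 eps + iota phi with eps
   and phi smooth; its values are then 1-jets of sections. *)
Definition jet_smooth (mu : forall m, jet_space m) : Prop :=
  exists (eps : dsec) (phi : homsec), forall m,
    mu m = j1_fun eps m + iota_fun phi m.

Record jet := MkJet {
  jet_fun :> forall m, jet_space m;
  jet_smoothP : jet_smooth jet_fun }.

Lemma jetP (mu nu : jet) : (forall m, mu m = nu m) -> mu = nu.
Proof.
case: mu nu => mu pmu [nu pnu] /= h.
have e : mu = nu by exact: functional_extensionality_dep.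
by subst nu; congr MkJet; exact: Prop_irrelevance.
Qed.

Lemma j1_funD eps eta m : j1_fun (eps + eta) m = j1_fun eps m + j1_fun eta m.
Proof.
congr (_, _); apply/funext => t; apply/funext => s /=.
have -> : pairing (eps + eta) s = pairing eps s + pairing eta s by exact: val_inj.
by rewrite tangentD.
Qed.

Lemma iota_funD phi psi m :
  iota_fun (phi + psi) m = iota_fun phi m + iota_fun psi m.
Proof. by congr (_, _); rewrite addr0. Qed.

Lemma j1_fun0 m : j1_fun 0 m = 0.
Proof. by apply: (addrI (j1_fun 0 m)); rewrite -j1_funD !addr0. Qed.

Lemma iota_fun0 m : iota_fun 0 m = 0.
Proof. by apply: (addrI (iota_fun 0 m)); rewrite -iota_funD !addr0. Qed.

Lemma j1_smooth eps : jet_smooth (j1_fun eps).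
Proof. by exists eps, 0 => m; rewrite iota_fun0 addr0. Qed.

Lemma iota_smooth phi : jet_smooth (iota_fun phi).
Proof. by exists 0, phi => m; rewrite j1_fun0 add0r. Qed.

Lemma jet0_subproof : jet_smooth (fun m => 0).
Proof. by exists 0, 0 => m; rewrite j1_fun0 iota_fun0 addr0. Qed.

Lemma jetD_subproof (mu nu : jet) : jet_smooth (fun m => mu m + nu m).
Proof.
case: mu nu => mu /= [e [p mE]] [nu /= [f [q nE]]]; exists (e + f), (p + q) => m.
by rewrite mE nE j1_funD iota_funD addrACA.
Qed.

Lemma jetN_subproof (mu : jet) : jet_smooth (fun m => - mu m).
Proof.
case: mu => mu /= [e [p mE]]; exists (- e), (- p) => m; rewrite mE opprD.
congr (_ + _); apply/eqP; rewrite eq_sym -addr_eq0.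
  by rewrite -j1_funD addNr j1_fun0.
by rewrite -iota_funD addNr iota_fun0.
Qed.

Definition jet0 := MkJet jet0_subproof.
Definition jetN mu := MkJet (jetN_subproof mu).
Definition jetD mu nu := MkJet (jetD_subproof mu nu).

HB.instance Definition _ := gen_eqMixin jet.
HB.instance Definition _ := gen_choiceMixin jet.

Lemma jet_addA : associative jetD.
Proof. by move=> x y z; apply: jetP => m /=; rewrite addrA. Qed.
Lemma jet_addC : commutative jetD.
Proof. by move=> x y; apply: jetP => m /=; rewrite addrC. Qed.
Lemma jet_add0 : left_id jet0 jetD.
Proof. by move=> x; apply: jetP => m /=; rewrite add0r. Qed.
Lemma jet_addN : left_inverse jet0 jetN jetD.
Proof. by move=> x; apply: jetP => m /=; rewrite addNr. Qed.

HB.instance Definition _ :=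
  GRing.isZmodule.Build jet jet_addA jet_addC jet_add0 jet_addN.

Definition j1 (eps : dsec) : jet := MkJet (j1_smooth eps).
Definition jiota (phi : homsec) : jet := MkJet (iota_smooth phi).

(* The pair (eps, phi) corresponding to mu: eps is the projection of mu and
   jiota phi = mu - j^1 eps. *)
Definition jet_pr (mu : jet) : dsec :=
  the 0 (fun eps : dsec => forall m, eps m = (mu m).1).
Definition jet_hom (mu : jet) : homsec :=
  the 0 (fun phi : homsec => jiota phi = mu - j1 (jet_pr mu)).

Definition der_jet (d : der) (mu : jet) : dsec :=
  d (jet_pr mu) + happ (jet_hom mu) (symb d).

Definition lie_jet (d : der) (mu : jet) : jet :=
  j1 (d (jet_pr mu)) + jiota (lie_hom d (jet_hom mu)).

Definition Theta (a : der * jet) : vfield TE * oneform TE :=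
  (der_hat a.1, dform (ell (jet_pr a.2)) + tilde (jet_hom a.2)).

(* The data of a Courant algebroid with pairing in the dual of E, on a vector
   bundle with space of sections S. *)
Record courant_structure (S : Type) := CourantStructure {
  cs_anchor : S -> vfield M;
  cs_der : S -> der;
  cs_pairing : S -> S -> dsec;
  cs_bracket : S -> S -> S }.

Definition omni_bracket (a b : der * jet) : der * jet :=
  (dcomm a.1 b.1,
   lie_jet a.1 b.2 - lie_jet b.1 a.2 + j1 (der_jet b.1 a.2)).

Definition omni_pairing (a b : der * jet) : dsec :=
  der_jet a.1 b.2 + der_jet b.1 a.2.

Definition omni_Lie : courant_structure (der * jet) :=
  {| cs_anchor := fun a => symb a.1;
     cs_der := fun a => a.1;
     cs_pairing := omni_pairing;
     cs_bracket := omni_bracket |}.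

Definition induced_bracket (a b : der * jet) : der * jet :=
  the (der0, 0) (fun c => Theta c = courant_dorfman (Theta a) (Theta b)).

Definition induced_pairing (a b : der * jet) : dsec :=
  the 0 (fun eps : dsec => ell eps = courant_pairing (Theta a) (Theta b)).

Definition induced_der (a : der * jet) : der :=
  the der0 (fun d => der_hat d = (Theta a).1).

Definition induced_structure : courant_structure (der * jet) :=
  {| cs_anchor := fun a => symb (induced_der a);
     cs_der := induced_der;
     cs_pairing := induced_pairing;
     cs_bracket := induced_bracket |}.

End bundle.

(* Main.v *)
Require Import Defs.
From HB Require Import structures.
From mathcomp Require Import all_boot all_order all_algebra.
From mathcomp Require Import ring.
From mathcomp Require Import all_classical all_reals all_analysis.
Import Order.TTheory GRing.Theory Num.Theory numFieldNormedType.Exports.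

(** Vector fields on [E] are determined by their values on the fibrewise linear
    functions [ell eps] and the pulled back functions [q^* f]; this gives
    [[hat d1, hat d2] = hat [d1, d2]] at once.  In a
    local frame [X_i] of [TM] dual to coordinate functions [f_i] one has
    [tilde phi = sum_i ell (phi X_i) d(q^* f_i)], and computing the Lie derivative
    of this expression yields [L_{hat d} (tilde phi) = tilde (L_d phi)].
    With Cartan's formula and [L_{hat d} d(ell eps) = d (ell (d eps))] the
    Courant-Dorfman bracket of two linear sections is then the image under [Theta]
    of the omni-Lie bracket, and [Theta] is injective: the Euler vector field of [E]
    recovers [eps] from [d(ell eps) + tilde phi].

    Since vector fields are derivations of the algebra of smooth functions, frames
    come from Hadamard's lemma and cut-off functions; pointwise objects
    ([d^*], [tilde phi], [L_d phi]) are obtained from [C^oo]-linear maps by locality. *)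

Set Implicit Arguments.
Unset Strict Implicit.
Unset Printing Implicit Defensive.

Local Open Scope classical_set_scope.
Local Open Scope ring_scope.

(** * Calculus on R^n *)

(** Two obstacles shape the proof. [Ck] speaks of directional derivatives only, so the chain rule
    across charts first needs that continuous partial derivatives give Frechet differentiability.
    Tangent vectors are abstract derivations of an algebra of global functions, so writing one as a
    combination of coordinate derivatives takes a Taylor expansion with smooth coefficients, and
    every local function has to be extended to the whole manifold. The objects [der_dual],
    [der_hat], [tilde] and [lie_hom] are given by [the], so nothing is known about them until an
    object with the defining property is exhibited; these existence proofs are where the frames
    enter. The Lie derivative of [tilde phi] comes out right because [X_i f_j] is locally constant:
    hence [[V, X_i] = - sum_j X_i(V f_j) X_j] for every field [V]. *)

Section row_calculus.
Variables (R : realType) (n : nat).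
Local Notation V := ('rV[R]_n : normedModType R).
Local Notation e_ i := (delta_mx 0 i : V).

Local Notation W := (R : normedModType R).

Definition lin_form (c : 'I_n -> R) (h : V) : W := \sum_i h 0 i * c i.

Lemma lin_form_linear c : linear (lin_form c).
Proof.
move=> a u v; rewrite /lin_form scaler_sumr -big_split /=.
by apply: eq_bigr => i _; rewrite !mxE mulrDl /GRing.scale /= mulrA.
Qed.

HB.instance Definition _ c :=
  GRing.isLinear.Build R V W _ (lin_form c) (lin_form_linear c).

Lemma lin_form_continuous c : continuous (lin_form c).
Proof.
apply: (@continuous_big _ _ _ _ xpredT) => [|i _ x]; first exact: add_continuous.
apply: (@continuousM _ _ (fun h : V => h 0 i) (cst (c i))).
  exact: coord_continuous.
exact: cst_continuous.
Qed.

Lemma coord_le_norm (h : V) i : `|h 0 i| <= `|h|.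
Proof.
rewrite [leRHS]/Num.Def.normr/= mx_normrE.
exact: (le_bigmax _ (fun ij => `|h ij.1 ij.2|) (0, i)).
Qed.

Lemma norm_rV_le (h : V) (e : R) : 0 <= e -> (forall i, `|h 0 i| <= e) -> `|h| <= e.
Proof.
move=> e0 he; rewrite [leLHS]/Num.Def.normr/= mx_normrE.
by apply: bigmax_le => // -[i j] _; rewrite ord1; exact: he.
Qed.

Lemma derivable_line (f : V -> R) (x v : V) (t : R) :
  derivable f (x + t *: v) v ->
  is_derive t 1 (fun s : R => f (x + s *: v)) ('D_v f (x + t *: v)).
Proof.
have E : (fun h : R => h^-1 *: (f (x + (h *: 1 + t) *: v) - f (x + t *: v))) =
         (fun h : R => h^-1 *: (f (h *: v + (x + t *: v)) - f (x + t *: v))).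
  apply/funext => h; congr (_ *: (f _ - _)).
  by rewrite scalerDl scaler1 addrCA.
move=> df; apply: DeriveDef; first by rewrite /derivable E.
by rewrite /derive E.
Qed.

(** The parameter is bounded by [|a|] instead of lying in an interval because [a] will be a
    coordinate increment, which may be negative; hence the two cases of the proof. *)
Lemma MVT_line (f : V -> W) (z v : V) (a : R) :
  (forall t : R, `|t| <= `|a| -> derivable f (z + t *: v) v) ->
  exists2 c : R, `|c| <= `|a| & f (z + a *: v) - f z = a * 'D_v f (z + c *: v).
Proof.
move=> df; pose phi (s : R) := f (z + s *: v).
have dl (s : R) : `|s| <= `|a| -> is_derive s 1 phi ('D_v f (z + s *: v)).
  by move=> sk; apply: derivable_line; exact: df.
have cphi (b c : R) : (forall s, s \in `[b, c] -> `|s| <= `|a|) ->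
    {within `[b, c], continuous phi}.
  move=> bc; apply: derivable_within_continuous => s /bc sk.
  exact: (@ex_derive _ _ _ _ _ _ _ (dl _ sk)).
have dphi (b c : R) : (forall s, s \in `[b, c] -> `|s| <= `|a|) ->
    forall s, s \in `]b, c[ -> is_derive s 1 phi ('D_v f (z + s *: v)).
  move=> bc s sbc; apply: dl; apply: bc.
  by move: sbc; apply: subset_itv_oo_cc.
have phi0 : phi 0 = f z by rewrite /phi scale0r addr0.
have [a0|a0] := leP 0 a.
  have I0 : forall s, s \in `[0, a] -> `|s| <= `|a|.
    by move=> s; rewrite in_itv /= => /andP[s0 sh]; rewrite !ger0_norm.
  have [s sI E] := MVT_segment a0 (dphi _ _ I0) (cphi _ _ I0).
  exists s; first exact: I0.
  by rewrite -phi0 -/(phi a) E subr0 mulrC.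
have I0 : forall s, s \in `[a, 0] -> `|s| <= `|a|.
  move=> s; rewrite in_itv /= => /andP[s0 sh].
  by rewrite (ler0_norm sh) (ler0_norm (ltW a0)) lerN2.
have [s sI E] := MVT_segment (ltW a0) (dphi _ _ I0) (cphi _ _ I0).
exists s; first exact: I0.
by rewrite -phi0 -/(phi a) -opprB E sub0r mulrN opprK mulrC.
Qed.

(** One passes from [x] to [x + h] by changing one coordinate at a time. The mean value theorem
    turns each move into a partial derivative at an intermediate point, and continuity compares it
    with the partial derivative at [x]. *)
Lemma differentiable_of_partials (f : V -> R) (x : V) :
  (\forall y \near x, forall i, derivable f y (e_ i)) ->
  (forall i, {for x, continuous ('D_(e_ i) f)}) ->
  differentiable f x /\ 'd f x = lin_form (fun i => 'D_(e_ i) f x) :> (V -> R).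
Proof.
move=> df cf; set c := fun i => 'D_(e_ i) f x.
have key : f \o shift x = cst (f x) + lin_form c +o_ (0 : V) id.
  apply/eqaddoP => _ /posnumP[e].
  (* Each of the [n] moves may cost [e' * |h|]; dividing by [n + 1] covers [n = 0] as well. *)
  pose e' := e%:num / n.+1%:R.
  have e'0 : 0 < e' by rewrite /e' divr_gt0.
  have cf' : \forall y \near x, forall i, `|'D_(e_ i) f x - 'D_(e_ i) f y| <= e'.
    near=> y => i; move: i; near: y; apply: filter_forall => i.
    have cfi : 'D_(e_ i) f @ x --> 'D_(e_ i) f x := cf i.
    by move/cvgrPdist_le : cfi => /(_ _ e'0).
  have : \forall y \near x,
      (forall i, derivable f y (e_ i)) /\
      (forall i, `|'D_(e_ i) f x - 'D_(e_ i) f y| <= e').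
    by apply: filterS2 df cf' => y; split.
  move=> /nbhs_ballP[d /= d0 hd].
  near=> h.
  have hd' : `|h| < d.
    by near: h; rewrite nbhs_simpl; exact: (@nbhs0_lt _ V).
  rewrite /= -[_ h]/(f (h + x) - (f x + lin_form c h)).
  (* The corner reached after [k] moves. *)
  pose p (k : nat) : V := \row_i (if (i < k)%N then x 0 i + h 0 i else x 0 i).
  have p0 : p 0%N = x by apply/rowP => i; rewrite !mxE.
  have pn : p n = h + x by apply/rowP => i; rewrite !mxE ltn_ord addrC.
  have step (k : 'I_n) : `|f (p k.+1) - f (p k) - h 0 k * c k| <= e' * `|h|.
    have pS : p k.+1 = p k + h 0 k *: e_ k.
      apply/rowP => i; rewrite !mxE eqxx /= ltnS leq_eqVlt eq_sym.
      rewrite (inj_eq val_inj); case: eqVneq => [->|ik] /=.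
        by rewrite ltnn mulr1.
      by rewrite mulr0 addr0.
    have pball (s : R) : `|s| <= `|h 0 k| -> ball x d (p k + s *: e_ k).
      move=> sk; rewrite -ball_normE /ball_ /=; apply: le_lt_trans hd'.
      apply: norm_rV_le => // i; rewrite !mxE eqxx /=.
      case: (ltngtP i k) => [ik|ik|/val_inj ->].
      - rewrite (_ : i == k = false) ?mulr0 ?addr0; last first.
          by rewrite -(inj_eq val_inj) ltn_eqF.
        by rewrite opprD addNKr normrN coord_le_norm.
      - rewrite (_ : i == k = false) ?mulr0 ?addr0 ?subrr ?normr0//.
        by rewrite -(inj_eq val_inj) gtn_eqF.
      - rewrite eqxx mulr1 opprD addNKr normrN.
        exact: le_trans sk (coord_le_norm _ _).
    have [s sk E] := MVT_line (fun s sk => (hd _ (pball s sk)).1 k).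
    rewrite pS E -mulrBr normrM mulrC distrC.
    by apply: ler_pM => //; [exact: (hd _ (pball _ sk)).2|exact: coord_le_norm].
  have -> : f (h + x) - (f x + lin_form c h) =
      \sum_(k < n) (f (p k.+1) - f (p k) - h 0 k * c k).
    rewrite big_split /= sumrN opprD addrA; congr (_ - _).
    have := telescope_sumr (fun k => f (p k)) (leq0n n).
    by rewrite big_mkord p0 pn.
  apply: le_trans (ler_norm_sum _ _ _) _.
  apply: (@le_trans _ _ (\sum_(k < n) e' * `|h|)).
    by apply: ler_sum => k _; exact: step.
  rewrite sumr_const card_ord -mulrnAl ler_wpM2r // /e' -mulr_natr.
  by rewrite -mulrA ler_piMr // mulrC ler_pdivrMr // mul1r ler_nat.
have E : 'd f x = lin_form c :> (V -> R).
  exact: (diff_unique (@lin_form_continuous c) key).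
split=> //; apply/diff_locallyP; split; last by rewrite E.
by rewrite E; exact: lin_form_continuous.
Unshelve. all: by end_near. Qed.
End row_calculus.

Section chain_rule.
Variables (R : realType) (n : nat).
Local Notation V := ('rV[R]_n : normedModType R).

Lemma derive_line (W : normedModType R) (f : V -> W) x v :
  'D_v f x = 'D_1 (fun h : R => f (h *: v + x)) 0.
Proof.
rewrite /derive; set g1 := fun h => h^-1 *: _; set g2 := fun h => h^-1 *: _.
suff -> : g1 = g2 by [].
by rewrite funeqE /g1 /g2 => h /=; rewrite addr0 scale0r add0r [_%:A]mulr1.
Qed.

(** Only one directional derivative of [f] is assumed, so the chain rule is applied to the curve
    [h |-> f (h v + x)]: for functions of one real variable derivability and differentiability
    coincide. *)
Lemma derive_comp_diff (W : normedModType R) (f : V -> W) (g : W -> (R : normedModType R)) x v :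
  derivable f x v -> differentiable g (f x) ->
  derivable (g \o f) x v /\ 'D_v (g \o f) x = 'd g (f x) ('D_v f x).
Proof.
move=> df dg; pose c (h : R) : W := f (h *: v + x).
have c0 : c 0 = f x by rewrite /c scale0r add0r.
have dc : differentiable c 0.
  by apply/derivable1_diffP; exact: (iffLR (derivable1P f x v) df).
have dg' : differentiable g (c 0) by rewrite c0.
have dgc := differentiable_comp dc dg'.
split.
  by apply: (iffRL (derivable1P _ _ _)); apply/derivable1_diffP.
rewrite derive_line -/(g \o c) deriveE // diff_comp //= c0.
by rewrite derive_line -/c deriveE.
Qed.

End chain_rule.

Section Ck_calculus.
Variables (R : realType) (n : nat).
Implicit Types (U : set 'rV[R]_n).
Local Notation W := (R : normedModType R).

Lemma Ck_sub (Z : normedModType R) k (U V : set 'rV[R]_n) (f : 'rV[R]_n -> Z) :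
  V `<=` U -> Ck k U f -> Ck k V f.
Proof.
move=> VU; elim: k f => [|k IH] f [cf df]; split=> //.
- by move=> x /VU; exact: cf.
- by move=> x /VU; exact: cf.
- by move=> v; have [dv Cv] := df v; split; [move=> x /VU; exact: dv|exact: IH].
Qed.

Lemma Ck_local (Z : normedModType R) k U (f : 'rV[R]_n -> Z) :
  (forall x, U x -> exists V : set 'rV[R]_n, V x /\ Ck k V f) -> Ck k U f.
Proof.
elim: k f => [|k IH] f h.
  by split=> // x /h [V [Vx [cf _]]]; exact: cf.
split=> [x /h [V [Vx [cf _]]]|v]; first exact: cf.
split=> [x /h [V [Vx [_ df]]]|]; first exact: (df v).1.
by apply: IH => x /h [V [Vx [_ df]]]; exists V; split=> //; exact: (df v).2.
Qed.

Lemma Ck_le (Z : normedModType R) k l U (f : 'rV[R]_n -> Z) :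
  (k <= l)%N -> Ck l U f -> Ck k U f.
Proof.
move=> /subnKC <-; elim: (l - k)%N => [|j IH]; first by rewrite addn0.
by rewrite addnS => /CkS; exact: IH.
Qed.

Lemma Ck_sum (I : Type) (s : seq I) k U (F : I -> 'rV[R]_n -> W) :
  open U -> (forall i, Ck k U (F i)) -> Ck k U (fun x => \sum_(i <- s) F i x).
Proof.
move=> oU CF; elim: s => [|i s IH].
  by apply: Ck_eq (Ck_cst _ _ (0 : W)) => // x _; rewrite big_nil.
apply: Ck_eq (CkD oU (CF i) IH) => // x _.
by rewrite big_cons.
Qed.

Lemma is_derive_coord (x v : 'rV[R]_n) i :
  is_derive x v (fun x : 'rV[R]_n => x 0 i : W) (v 0 i).
Proof.
have E : (fun h : R => h^-1 *: ((h *: v + x) 0 i - x 0 i)) @ 0^' --> v 0 i.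
  apply: cvg_near_cst; near=> h.
  rewrite !mxE addrK scalerA mulVf ?scale1r //.
  by near: h; exact: nbhs_dnbhs_neq.
apply: DeriveDef; first by apply/cvg_ex; exists (v 0 i).
by apply/cvg_lim.
Unshelve. all: by end_near. Qed.

Lemma Ck_coord k U i : Ck k U (fun x : 'rV[R]_n => x 0 i : W).
Proof.
have cc x : {for x, continuous (fun x : 'rV[R]_n => x 0 i : W)}.
  exact: coord_continuous.
case: k => [|k]; split=> // v; have D x := is_derive_coord x v i.
split=> [x _|]; first exact: (@ex_derive _ _ _ _ _ _ _ (D x)).
have -> : 'D_v (fun x : 'rV[R]_n => x 0 i : W) = cst (v 0 i).
  by apply/funext => x; exact: (@derive_val _ _ _ _ _ _ _ (D x)).
exact: Ck_cst.
Qed.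

Lemma Ck1_differentiable U (f : 'rV[R]_n -> W) x : open U -> Ck 1 U f -> U x ->
  differentiable f x /\
  'd f x = lin_form (fun i => 'D_(delta_mx 0 i) f x) :> (_ -> _).
Proof.
move=> oU [cf df] Ux; apply: differentiable_of_partials.
  near=> y => i; apply: (df _).1; near: y.
  exact: open_nbhs_nbhs.
by move=> i; exact: (df (delta_mx 0 i)).2.1.
Unshelve. all: by end_near. Qed.

Lemma Ck1_derive U (f : 'rV[R]_n -> W) x v : open U -> Ck 1 U f -> U x ->
  'D_v f x = \sum_i v 0 i * 'D_(delta_mx 0 i) f x.
Proof.
by move=> oU Cf Ux; have [df E] := Ck1_differentiable oU Cf Ux; rewrite deriveE // E.
Qed.

(** The derivative is [- f^-2] times that of [f], and [f^-1] is already known to be one order less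
    smooth. *)
Lemma CkV k U (f : 'rV[R]_n -> W) : open U -> (forall x, U x -> f x != 0) ->
  Ck k U f -> Ck k U (fun x => (f x)^-1).
Proof.
move=> oU f0; elim: k => [|k IH] Cf.
  by split=> // x Ux; apply: continuousV; [exact: f0|exact: Cf.1].
have CV := IH (CkS Cf).
case: Cf => cf df; split=> [x Ux|v].
  by apply: continuousV; [exact: f0|exact: cf].
have [dv Cv] := df v; split=> [x Ux|].
  by apply: derivableV; [exact: f0|exact: dv].
pose F := cst (-1) * ((fun x => (f x)^-1) * (fun x => (f x)^-1)) * 'D_v f.
apply: (@Ck_eq _ _ _ _ _ F) => //.
  move=> x Ux; rewrite deriveV ?f0 //; last exact: dv.
  have -> : F x = -1 * ((f x)^-1 * (f x)^-1) * 'D_v f x by [].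
  by rewrite mulN1r -expr2 exprVn.
by apply: CkM => //; apply: CkM => //; [exact: Ck_cst|exact: CkM].
Qed.

End Ck_calculus.

Section Ck_composition.
Variables (R : realType) (n : nat).
Implicit Types (U : set 'rV[R]_n).
Local Notation W := (R : normedModType R).

Lemma continuous_rV (p : nat) (f : 'rV[R]_n -> 'rV[R]_p)
    (x : ('rV[R]_n : normedModType R)) :
  (forall i, {for x, continuous (fun y => f y 0 i)}) -> {for x, continuous f}.
Proof.
move=> cf; suff : f y @[y --> x] --> f x by [].
apply/(@cvgrPdist_le _ _ _ (nbhs x)) => e e0; near=> y; apply: norm_rV_le; first exact: ltW.
move=> i; rewrite !mxE; move: i; near: y; apply: filter_forall => i.
have cfi : f y 0 i @[y --> x] --> f x 0 i := cf i.
by move/cvgrPdist_le : cfi => /(_ _ e0).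
Unshelve. all: by end_near. Qed.

(** By the chain rule the derivative of [g \o f] is a sum of products of a derivative of a component
    of [f] with a partial derivative of [g] composed with [f]. The latter is again a composition, so
    the induction on [k] is over all [g]. *)
Lemma Ck_comp (p k : nat) U (Z : set 'rV[R]_p) (g : 'rV[R]_p -> W)
    (f : 'rV[R]_n -> 'rV[R]_p) :
  open U -> open Z -> (forall x, U x -> Z (f x)) ->
  (forall i, Ck k U (fun x => f x 0 i : W)) -> Ck k Z g -> Ck k U (g \o f).
Proof.
move=> oU oZ fUZ; have C0 j h : (forall i, Ck j U (fun x => f x 0 i : W)) ->
    Ck j Z h -> forall x, U x -> {for x, continuous (h \o f)}.
  move=> Cf Ch x Ux; apply: continuous_comp.
    by apply: continuous_rV => i; case: j Cf {Ch} => [|j] Cf; exact: (Cf i).1.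
  by case: j Ch {Cf} => [|j] Ch; apply: Ch.1; exact: fUZ.
elim: k g => [|k IH] g Cf Cg; first by split=> //; exact: C0 Cg.
split; first exact: C0 Cg.
move=> v.
have key x : U x -> derivable (g \o f) x v /\ 'D_v (g \o f) x =
    \sum_i 'D_v (fun x => f x 0 i : W) x * 'D_(delta_mx 0 i) g (f x).
  move=> Ux; have [dg dgE] := Ck1_differentiable oZ (Ck_le (ltn0Sn k) Cg) (fUZ _ Ux).
  have df : derivable f x v.
    by apply/derivable_mxP => i j; rewrite ord1; exact: ((Cf j).2 v).1.
  have [d1 ->] := derive_comp_diff df dg; split=> //.
  by rewrite dgE /lin_form; apply: eq_bigr => i _; rewrite derive_mx // mxE.
split=> [x Ux|]; first by have [] := key x Ux.
apply: Ck_eq (_ : Ck k U (fun x => \sum_i ('D_v (fun x => f x 0 i : W) *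
                         ('D_(delta_mx 0 i) g \o f)) x)) => //.
  by move=> x Ux; have [_ ->] := key x Ux.
apply: Ck_sum => // i; apply: CkM => //; first exact: ((Cf i).2 v).2.
by apply: IH => [j|]; [exact: CkS|exact: (Cg.2 _).2].
Qed.

Lemma smooth_coord (p : nat) U (f : 'rV[R]_n -> 'rV[R]_p) k i :
  open U -> Ck k U f -> Ck k U (fun x => f x 0 i : W).
Proof.
move=> oU; elim: k f => [|k IH] f Cf.
  by split=> // x Ux; apply: (@continuous_comp _ _ _ f (fun y : 'rV[R]_p => y 0 i) x (Cf.1 x Ux));
    exact: coord_continuous.
split=> [x Ux|v].
  by apply: (@continuous_comp _ _ _ f (fun y : 'rV[R]_p => y 0 i) x (Cf.1 x Ux));
    exact: coord_continuous.
have [dv Cv] := Cf.2 v; split=> [x Ux|]; first by have /derivable_mxP := dv x Ux; exact.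
apply: Ck_eq (IH _ Cv) => // x Ux.
by rewrite derive_mx ?mxE //; exact: dv.
Qed.

End Ck_composition.

(** * Cut-off functions *)

Section flat_function.
Variable R : realType.
Implicit Types p : {poly R}.
Local Notation W := (R : normedModType R).

Definition flat p (x : R) : R := if 0 < x then p.[x^-1] * expR (- x^-1) else 0.

Lemma flat_le0 p x : x <= 0 -> flat p x = 0.
Proof. by rewrite /flat ltNge => ->. Qed.

(** Coefficient by coefficient, from [y^i / i! <= exp y], a single term of the exponential
    series. *)
Lemma horner_expR_le p : exists2 C : R, 0 <= C &
  forall y, 0 <= y -> `|p.[y]| <= C * expR y.
Proof.
exists (\sum_(i < size p) `|p`_i| * i`!%:R).
  by apply: sumr_ge0 => i _; rewrite mulr_ge0.
move=> y y0; rewrite horner_coef mulr_suml.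
apply: le_trans (ler_norm_sum _ _ _) _; apply: ler_sum => i _.
rewrite normrM -mulrA ler_wpM2l // ger0_norm ?exprn_ge0 //.
case: (nat_of_ord i) => [|j]; first by rewrite expr0 mul1r -expR0 ler_expR.
rewrite mulrC -ler_pdivrMr ?ltr0n ?fact_gt0 //.
by apply: le_trans (expR_ge1Dxn j y0); rewrite lerDr.
Qed.

Lemma flat_cvg0 p : flat p x @[x --> (0 : R)] --> (0 : R).
Proof.
(* The extra factor ['X] is evaluated at [x^-1]; moved to the other side it gives
   [|flat p x| <= C x] for positive [x]. *)
have [C C0 hC] := horner_expR_le (p * 'X).
apply/(@cvgrPdist_le _ _ _ (nbhs (0 : R))) => e e0; near=> x; rewrite sub0r normrN /flat.
case: ifP => [x0|_]; last by rewrite normr0 ltW.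
have y0 : 0 <= x^-1 by rewrite invr_ge0 ltW.
have := hC _ y0; rewrite hornerMX normrM (ger0_norm y0) -ler_pdivlMr ?invr_gt0 //.
rewrite invrK => hx.
rewrite normrM (ger0_norm (expR_ge0 _)) expRN.
apply: (@le_trans _ _ (C * x)).
  by rewrite ler_pdivrMr ?expR_gt0 // mulrAC.
(* [C] may be zero, and the bound on [x] is going to be [e / (C + 1)]. *)
apply: (@le_trans _ _ ((C + 1) * x)); first by rewrite ler_wpM2r ?lerDl // ltW.
rewrite mulrC -ler_pdivlMr ?ltr_wpDl //.
apply: le_trans (ler_norm _) _; near: x.
by rewrite nbhs_simpl; apply: (@nbhs0_le _ W); rewrite divr_gt0 // ltr_wpDl.
Unshelve. all: by end_near. Qed.

(* [flat p] has derivative [flat (flat_deriv p)] everywhere, also at [0], so a single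
   induction shows that all the functions [flat p] are smooth. *)
Definition flat_deriv p := 'X ^+ 2 * (p - p^`()).

Lemma is_derive_flat p (x : W) : is_derive x (1 : W) (flat p : W -> W) (flat (flat_deriv p) x).
Proof.
have [x0|x0|->] := ltgtP x 0.
- rewrite flat_le0 ?ltW //.
  apply: near_eq_is_derive (is_derive_cst (0 : W) x (1 : W)).
  near=> y; rewrite flat_le0 //; apply: ltW; near: y; exact: lt_nbhsl.
- pose g (y : W) : W := p.[y^-1] * expR (- y^-1).
  suff dg : is_derive x (1 : W) g (flat (flat_deriv p) x).
    apply: near_eq_is_derive dg.
    near=> y; rewrite /flat /g; case: ifP => // /negP[]; near: y; exact: lt_nbhsr.
  have dV : is_derive x (1 : W) (fun y : W => y^-1 : W) (- x ^- 2).
    apply: DeriveDef; first by apply: derivableV; rewrite ?gt_eqF //; exact: derivable_id.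
    by rewrite deriveV ?gt_eqF // derive_id scaler1.
  have d1 := is_derive1_comp (is_derive_poly p x^-1) dV.
  have dN : is_derive x (1 : W) (fun y : W => - y^-1 : W) (x ^- 2).
    by have := is_deriveN dV; rewrite opprK.
  have d2 := @is_derive1_comp R expR (fun y => - y^-1) x _ _
    (is_derive_expR (- x^-1)) dN.
  have d3 := @is_deriveM R W _ _ _ _ _ _ d1 d2.
  apply: is_derive_eq d3 _.
  rewrite /flat x0 /flat_deriv !hornerE /= /GRing.scale /= exprVn.
  by ring.
- rewrite flat_le0 //.
  (* At the origin the difference quotient is itself a flat function, so its limit is zero by
     [flat_cvg0]. *)
  have E : (fun h : R => h^-1 *: (flat p (h *: 1 + 0) - flat p 0)) = flat (p * 'X).
    apply/funext => h; rewrite addr0 scaler1 (flat_le0 _ (lexx 0)) subr0 /flat.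
    case: ifP => _; last by rewrite scaler0.
    by rewrite hornerMX /GRing.scale /= mulrCA mulrA.
  have cv : h^-1 *: (flat p (h *: 1 + 0) - flat p 0) @[h --> 0^'] --> (0 : W).
    by rewrite E; apply: cvg_within_filter; exact: flat_cvg0.
  apply: DeriveDef; first by apply/cvg_ex; exists 0.
  exact/cvg_lim.
Unshelve. all: by end_near. Qed.

Lemma Ck_flat n k (U : set 'rV[R]_n) p (h : 'rV[R]_n -> W) :
  open U -> Ck k U h -> Ck k U (flat p \o h).
Proof.
move=> oU; have dflat q (y : W) : differentiable (flat q : W -> W) y.
  by apply/derivable1_diffP; exact: (@ex_derive _ _ _ _ _ _ _ (is_derive_flat q y)).
have C0 q j : Ck j U h -> forall x, U x -> {for x, continuous (flat q \o h)}.
  move=> Ch x Ux; apply: continuous_comp; first by case: j Ch => [|j] Ch; exact: Ch.1.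
  exact: differentiable_continuous.
elim: k p => [|k IH] p Ch; first by split=> //; exact: C0 Ch.
split; first exact: C0 Ch.
move=> v; have key x : U x -> derivable (flat p \o h) x v /\
    'D_v (flat p \o h) x = (flat (flat_deriv p) \o h) x * 'D_v h x.
  move=> Ux; have [d1 ->] := derive_comp_diff ((Ch.2 v).1 x Ux) (dflat p (h x)).
  split=> //; rewrite -deriveE //.
  have /derivable1_diffP := dflat p (h x).
  move=> /deriv1E => Ed; rewrite deriveE // Ed derive1E.
  by rewrite (@derive_val _ _ _ _ _ _ _ (is_derive_flat p (h x))) mulrC.
split=> [x Ux|]; first by have [] := key x Ux.
apply: Ck_eq (CkM oU (IH (flat_deriv p) (CkS Ch)) (Ch.2 v).2) => // x Ux.
by have [_ ->] := key x Ux.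
Qed.

Definition smooth_step (t : R) : R := flat 1 t / (flat 1 t + flat 1 (1 - t)).

Lemma flat1_ge0 t : 0 <= flat 1 t.
Proof. by rewrite /flat; case: ifP => // _; rewrite hornerE mul1r expR_ge0. Qed.

Lemma flat1_gt0 t : 0 < t -> 0 < flat 1 t.
Proof. by move=> t0; rewrite /flat t0 hornerE mul1r expR_gt0. Qed.

Lemma smooth_step_den t : 0 < flat 1 t + flat 1 (1 - t).
Proof.
have [t0|t0] := ltP 0 t; first by rewrite ltr_wpDr ?flat1_ge0 ?flat1_gt0.
by rewrite ltr_wpDl ?flat1_ge0 ?flat1_gt0 // subr_gt0 (le_lt_trans t0).
Qed.

Lemma smooth_step1 t : 1 <= t -> smooth_step t = 1.
Proof.
move=> t1; have := smooth_step_den t; rewrite /smooth_step.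
rewrite (@flat_le0 _ (1 - t)) ?subr_le0 // addr0 => h.
by rewrite divff // gt_eqF.
Qed.

Lemma smooth_step0 t : t <= 0 -> smooth_step t = 0.
Proof. by move=> t0; rewrite /smooth_step flat_le0 // mul0r. Qed.

Lemma Ck_smooth_step n k (U : set 'rV[R]_n) (h : 'rV[R]_n -> W) :
  open U -> Ck k U h -> Ck k U (smooth_step \o h).
Proof.
move=> oU Ch.
have C1 : Ck k U (fun x => 1 - h x : W).
  apply: Ck_eq (CkD oU (Ck_cst k U (1 : W)) (CkM oU (Ck_cst k U (-1 : W)) Ch)) => //.
  by move=> x _; rewrite !fctE mulN1r.
have Cd : Ck k U (fun x => (flat 1 (h x) + flat 1 (1 - h x) : W)^-1).
  apply: CkV => // [x _|]; first by rewrite gt_eqF // smooth_step_den.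
  exact: CkD (Ck_flat 1 oU Ch) (Ck_flat 1 oU C1).
exact: CkM (Ck_flat 1 oU Ch) Cd.
Qed.

Lemma exists_bump n (y0 : 'rV[R]_n) (e : R) : 0 < e ->
  exists b : 'rV[R]_n -> W, [/\ forall k U, open U -> Ck k U b,
    \forall y \near y0, b y = 1 & forall y, b y != 0 -> `|y - y0| <= e].
Proof.
move=> e0.
(* The squared Euclidean distance: it is smooth, unlike the norm of the row space, which is a
   maximum, and it dominates the square of that norm. *)
pose q (y : 'rV[R]_n) : W := \sum_(i <- index_enum 'I_n) (y 0 i - y0 0 i) ^+ 2.
have Cq k U : open U -> Ck k U q.
  move=> oU; apply: Ck_sum => // i.
  have Ci : Ck k U (fun y : 'rV[R]_n => y 0 i - y0 0 i : W).
    exact: CkD (Ck_coord k U i) (Ck_cst k U (- y0 0 i : W)).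
  by apply: Ck_eq (CkM oU Ci Ci) => // y _; rewrite expr2.
(* The constants make [h] equal to 2 at [y0], hence above 1 nearby, where the step is 1, and
   positive only where [q < e^2]. *)
pose h (y : 'rV[R]_n) : W := 2 - 2 / e ^+ 2 * q y.
have Ch k U : open U -> Ck k U h.
  move=> oU; apply: Ck_eq (CkD oU (Ck_cst k U (2 : W))
    (CkM oU (Ck_cst k U (- (2 / e ^+ 2) : W)) (Cq k U oU))) => // y _.
  by rewrite !fctE mulNr.
exists (smooth_step \o h); split.
- by move=> k U oU; apply: Ck_smooth_step => //; exact: Ch.
- have ch : h y @[y --> y0] --> h y0.
    by have [H _] := Ch 0%N setT openT; exact: H.
  have h0 : h y0 = 2.
    by rewrite /h /q big1 ?mulr0 ?subr0 // => i _; rewrite subrr expr0n.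
  have : \forall y \near y0, 1 < h y.
    by move: ch; rewrite h0 => /cvgr_gt; apply; rewrite ltr1n.
  by apply: filterS => y hy; apply: smooth_step1; exact: ltW.
- move=> y b0; have hy : 0 < h y.
    by rewrite ltNge; apply: contra b0 => hy; rewrite /= smooth_step0.
  apply: norm_rV_le => [|i]; first exact: ltW.
  have : q y < e ^+ 2.
    move: hy; rewrite /h subr_gt0 mulrC -ltr_pdivlMr; last by rewrite divr_gt0 // exprn_gt0.
    by rewrite invf_div mulrCA divff // mulr1.
  move=> qe; have : (y 0 i - y0 0 i) ^+ 2 <= e ^+ 2.
    apply: le_trans (ltW qe); rewrite /q (bigD1 i) //= lerDl.
    by apply: sumr_ge0 => j _; exact: sqr_ge0.
  rewrite !mxE => h2; rewrite -(ler_pXn2r (ltn0Sn 1)) ?nnegrE ?normr_ge0 ?(ltW e0) //.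
  by rewrite real_normK ?num_real.
Qed.

End flat_function.

(** * Hadamard's lemma *)

Section unit_integral.
Variable R : realType.
Local Notation W := (R : normedModType R).
Local Notation mu := (@lebesgue_measure R).
Implicit Types f g : R -> R.

Definition int01 f : R := \int[mu]_(s in `[0, 1]) f s.

Definition cont01 f := {within `[0, 1], continuous f}.

Lemma cont01_integrable f : cont01 f -> mu.-integrable `[0, 1] (EFin \o f).
Proof.
by move=> cf; apply: continuous_compact_integrable => //; exact: segment_compact.
Qed.

Lemma int01_cst (c : R) : int01 (cst c) = c.
Proof.
rewrite /int01 Rintegral_cst //= lebesgue_measure_itv /= lte_fin ltr01.
by rewrite oppr0 adde0 mulr1.
Qed.

Lemma int01D f g : cont01 f -> cont01 g -> int01 (fun s => f s + g s) = int01 f + int01 g.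
Proof. by move=> cf cg; rewrite /int01 RintegralD //; exact: cont01_integrable. Qed.

Lemma int01Z (a : R) f : cont01 f -> int01 (fun s => a * f s) = a * int01 f.
Proof. by move=> cf; rewrite /int01 RintegralZl //; exact: cont01_integrable. Qed.

Lemma eq_int01 f g : (forall s, 0 <= s <= 1 -> f s = g s) -> int01 f = int01 g.
Proof. by move=> fg; apply: eq_Rintegral => s; rewrite inE /= in_itv /= => /fg. Qed.

Lemma cont01D f g : cont01 f -> cont01 g -> cont01 (fun s => f s + g s).
Proof. by move=> cf cg x; apply: cvgD; [exact: cf|exact: cg]. Qed.

Lemma cont01M f g : cont01 f -> cont01 g -> cont01 (fun s => f s * g s).
Proof. by move=> cf cg x; apply: cvgM; [exact: cf|exact: cg]. Qed.

Lemma cont01_cst (c : R) : cont01 (fun=> c).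
Proof. by move=> x; exact: cvg_cst. Qed.

Lemma int01_dist_le f g e : cont01 f -> cont01 g ->
  (forall s, 0 <= s <= 1 -> `|f s - g s| <= e) -> `|int01 f - int01 g| <= e.
Proof.
move=> cf cg fg.
have cfg : cont01 (fun s => f s - g s).
  by move=> x; apply: cvgB; [exact: cf|exact: cg].
have -> : int01 f - int01 g = int01 (fun s => f s - g s).
  by rewrite /int01 RintegralB //; exact: cont01_integrable.
apply: le_trans (le_normr_Rintegral _ _) _ => //; first exact: cont01_integrable.
rewrite -[leRHS]int01_cst; apply: le_Rintegral => //.
- apply: cont01_integrable => x; apply: cvg_norm; exact: cfg.
- exact/cont01_integrable/cont01_cst.
Qed.

Lemma int01_FTC (F f : R -> R) :
  (forall s, 0 <= s <= 1 -> is_derive (s : W) (1 : W) (F : W -> W) (f s)) ->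
  cont01 f -> int01 f = F 1 - F 0.
Proof.
move=> dF cf; rewrite /int01 /Rintegral (@continuous_FTC2 _ f F) //.
- have cF s : 0 <= s <= 1 -> {for s, continuous F}.
    move=> /dF dFs; apply: differentiable_continuous; apply/derivable1_diffP.
    exact: (@ex_derive _ _ _ _ _ _ _ dFs).
  split.
  + move=> s; rewrite in_itv /= => /andP[s0 s1].
    by apply: (@ex_derive _ _ _ _ _ _ _ (dF s _)); rewrite !ltW.
  + by apply: cvg_at_right_filter; apply: cF; rewrite lexx ler01.
  + by apply: cvg_at_left_filter; apply: cF; rewrite lexx ler01.
- move=> s; rewrite in_itv /= => /andP[s0 s1].
  by rewrite derive1E; apply: (@derive_val _ _ _ _ _ _ _ (dF s _)); rewrite !ltW.
Qed.

End unit_integral.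

Section hadamard.
Variables (R : realType) (n : nat).
Local Notation V := ('rV[R]_n : normedModType R).
Local Notation W := (R : normedModType R).
Variables (y0 : V) (U : set V).
Let seg (y : V) (s : R) : V := y0 + s *: (y - y0).
Hypothesis oU : open U.
Hypothesis star : forall y s, U y -> 0 <= s <= 1 -> U (seg y s).

Lemma seg_continuous y : continuous (seg y).
Proof.
move=> s; apply: cvgD; first exact: cvg_cst.
by apply: cvgZr_tmp; exact: cvg_id.
Qed.

(** Compactness of [[0, 1]], in its near-covering form, makes one neighbourhood of 0 work for all
    [s]. This uniformity is what allows limits and derivatives under the integral. *)
Lemma seg_uniform (f : V -> W) (y : V) e : (forall x, U x -> {for x, continuous f}) ->
  U y -> 0 < e ->
  \forall h \near (0 : V), forall s, 0 <= s <= 1 ->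
    U (seg y s + h) /\ `|f (seg y s + h) - f (seg y s)| <= e.
Proof.
move=> cf Uy e0.
have K := (iffLR (compact_near_coveringP _) (@segment_compact R 0 1)).
have := K V (nbhs (0 : V))
  (fun h s => U (seg y s + h) /\ `|f (seg y s + h) - f (seg y s)| <= e) _.
move=> H; near=> h => s s01.
suff : `[0, 1] `<=` (fun s => U (seg y s + h) /\ `|f (seg y s + h) - f (seg y s)| <= e).
  by apply; rewrite /= in_itv.
near: h; apply: H => s; rewrite /= in_itv /= => s01.
have Us := star Uy s01.
have cs : seg y t @[t --> s] --> seg y s := @seg_continuous y s.
have e2 : 0 < e / 2 by rewrite divr_gt0.
have cfs : f x @[x --> seg y s] --> f (seg y s) := cf _ Us.
have Nf : \forall x \near seg y s, U x /\ `|f (seg y s) - f x| <= e / 2.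
  apply: filterI; first exact: open_nbhs_nbhs.
  by move/cvgrPdist_le : cfs; apply.
have cp : (seg y p.1 + p.2) @[p --> (s, 0 : V)] --> seg y s + 0.
  apply: cvgD; last exact: cvg_snd.
  exact: (cvg_comp _ _ cvg_fst cs).
rewrite addr0 in cp.
have N1 : \forall p \near ((s, 0) : R * V), U (seg y p.1 + p.2) /\
    `|f (seg y s) - f (seg y p.1 + p.2)| <= e / 2 by exact: cp Nf.
have N2 : \forall p \near ((s, 0) : R * V), `|f (seg y s) - f (seg y p.1)| <= e / 2.
  have : \forall t \near s, `|f (seg y s) - f (seg y t)| <= e / 2.
    by apply: (cs (fun x => `|f (seg y s) - f x| <= e / 2)); apply: filterS Nf => x [].
  by move=> Nt; exact: (cvg_fst Nt).
have : \forall p \near ((s, 0) : R * V), U (seg y p.1 + p.2) /\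
    `|f (seg y p.1 + p.2) - f (seg y p.1)| <= e.
  apply: filterS2 N1 N2 => -[t h'] /= [Uh h1] h2; split=> //.
  rewrite -(subrKA (f (seg y s))) (splitr e).
  by apply: le_trans (ler_normD _ _) _; rewrite lerD // distrC.
by [].
Unshelve. all: by end_near. Qed.

Definition seg_int (k : nat) (f : V -> W) (y : V) : W :=
  int01 (fun s => s ^+ k * f (seg y s)).

Lemma seg_cont01 k (f : V -> W) y : (forall x, U x -> {for x, continuous f}) ->
  U y -> cont01 (fun s => s ^+ k * f (seg y s)).
Proof.
move=> cf Uy; apply: continuous_in_subspaceT => s.
rewrite inE /= in_itv /= => s01.
apply: (@continuousM _ _ (fun s : R => s ^+ k) (fun s => f (seg y s))).
  exact: exprn_continuous.
apply: (@continuous_comp _ _ _ (seg y) f); first exact: seg_continuous.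
by apply: cf; exact: star.
Qed.

Lemma seg_int_continuous k (f : V -> W) y : (forall x, U x -> {for x, continuous f}) ->
  U y -> {for y, continuous (seg_int k f)}.
Proof.
move=> cf Uy; suff : seg_int k f x @[x --> y] --> seg_int k f y by [].
apply/(@cvgrPdist_le _ _ _ (nbhs y)) => e e0.
have := seg_uniform cf Uy e0 => /nbhs_ballP[d /= d0 hd].
near=> x.
have xd : `|x - y| < d.
  near: x; rewrite nbhs_simpl; apply/nbhs_ballP; exists d => //= x.
  by rewrite -ball_normE /ball_ /= distrC.
have Ux : U x by near: x; rewrite nbhs_simpl; exact: open_nbhs_nbhs.
apply: int01_dist_le => [||s s01]; [exact: seg_cont01..|].
have segE : seg x s = seg y s + s *: (x - y).
  rewrite /seg -addrA -scalerDr; congr (_ + _ *: _).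
  by rewrite [RHS]addrC subrKA.
case/andP: (s01) => s0 s1.
rewrite -mulrBr normrM normrX (ger0_norm s0) -[leRHS]mul1r.
apply: ler_pM => //; [exact: exprn_ge0|exact: exprn_ile1|].
rewrite distrC segE; apply: (hd _ _ _ _).2 => //.
rewrite -ball_normE /ball_ /= sub0r normrN normrZ (ger0_norm s0).
by apply: le_lt_trans xd; rewrite ler_piMl.
Unshelve. all: by end_near. Qed.

(* [D_v] of the integral of [s^k f(y0 + s (y - y0))] produces one more factor [s]:
   this is why all the weights [s^k] are considered at once. *)
Lemma seg_int_derive k (f : V -> W) (v y : V) :
  (forall x, U x -> {for x, continuous f}) ->
  (forall x, U x -> derivable f x v) ->
  (forall x, U x -> {for x, continuous ('D_v f)}) -> U y ->
  is_derive y v (seg_int k f) (seg_int k.+1 ('D_v f) y).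
Proof.
move=> cf df cdf Uy.
suff E : (fun h : R => h^-1 *: (seg_int k f (h *: v + y) - seg_int k f y)) @ 0^' -->
    seg_int k.+1 ('D_v f) y.
  apply: DeriveDef; first by apply/cvg_ex; eexists; exact: E.
  exact: cvg_lim.
apply/(@cvgrPdist_le _ _ _ 0^') => e e0.
have := seg_uniform cdf Uy e0 => /nbhs_ballP[d /= d0 hd].
have Nv : \forall h \near (0 : R), U (h *: v + y) /\ `|h *: v| < d.
  have c1 : h *: v + y @[h --> (0 : R)] --> 0 *: v + y.
    by apply: cvgD; [apply: cvgZr_tmp; exact: cvg_id|exact: cvg_cst].
  have c2 : `|h *: v| @[h --> (0 : R)] --> `|0 *: v|.
    by apply: cvg_norm; apply: cvgZr_tmp; exact: cvg_id.
  apply: filterI.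
    by apply: c1; rewrite scale0r add0r; exact: open_nbhs_nbhs.
  by move/cvgr_lt : c2; apply; rewrite scale0r normr0.
near=> h.
have h0 : h != 0 by near: h; rewrite nbhs_simpl; exact: nbhs_dnbhs_neq.
have [Uh hvd] : U (h *: v + y) /\ `|h *: v| < d.
  by near: h; rewrite nbhs_simpl; exact: nbhs_dnbhs.
have [ch cy] := (seg_cont01 (k := k) cf Uh, seg_cont01 (k := k) cf Uy).
have -> : h^-1 *: (seg_int k f (h *: v + y) - seg_int k f y) =
    int01 (fun s => h^-1 * (s ^+ k * f (seg (h *: v + y) s)) +
                    - h^-1 * (s ^+ k * f (seg y s))).
  rewrite int01D ?int01Z //; try by apply: cont01M => //; exact: cont01_cst.
  by rewrite mulNr -mulrBr.
apply: (int01_dist_le (seg_cont01 (k := k.+1) cdf Uy)).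
  by apply: cont01D; apply: cont01M => //; exact: cont01_cst.
move=> s s01; case/andP: (s01) => s0 s1.
have segE : seg (h *: v + y) s = seg y s + (s * h) *: v.
  by rewrite /seg -[h *: v + y - y0]addrA scalerDr scalerA addrCA addrC.
have hdt (t : R) : `|t| <= `|s * h| -> ball (0 : V) d (t *: v).
  move=> ht; rewrite -ball_normE /ball_ /= sub0r normrN.
  apply: le_lt_trans hvd; rewrite !normrZ ler_wpM2r //.
  by apply: le_trans ht _; rewrite normrM (ger0_norm s0) ler_piMl.
(* The intermediate parameter [t] depends on [s], but [t v] always stays in the ball of radius [d],
   where the estimate is uniform in [s]. *)
have [t ht E] := @MVT_line R n f (seg y s) v (s * h)
  (fun t ht => df _ (hd _ (hdt t ht) _ s01).1).
rewrite mulNr -mulrBr -mulrBr segE E.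
have -> : h^-1 * (s ^+ k * (s * h * 'D_v f (seg y s + t *: v))) =
    s ^+ k.+1 * 'D_v f (seg y s + t *: v).
  by rewrite exprSr; field.
rewrite -mulrBr normrM normrX (ger0_norm s0) -[leRHS]mul1r.
apply: ler_pM => //; [exact: exprn_ge0|exact: exprn_ile1|].
by rewrite distrC; exact: (hd _ (hdt t ht) _ s01).2.
Unshelve. all: by end_near. Qed.

Lemma Ck_seg_int l k (f : V -> W) : Ck l U f -> Ck l U (seg_int k f).
Proof.
elim: l k f => [|l IH] k f Cf.
  by split=> // x Ux; apply: seg_int_continuous => //; exact: Cf.1.
split=> [x Ux|v]; first by apply: seg_int_continuous => //; exact: Cf.1.
have D x : U x -> is_derive x v (seg_int k f) (seg_int k.+1 ('D_v f) x).
  apply: seg_int_derive; [exact: Cf.1|exact: (Cf.2 v).1|].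
  by case: l {IH} Cf => [|l] Cf; exact: (Cf.2 v).2.1.
split=> [x Ux|]; first exact: (@ex_derive _ _ _ _ _ _ _ (D x Ux)).
apply: Ck_eq (IH k.+1 _ (Cf.2 v).2) => // x Ux.
by rewrite (@derive_val _ _ _ _ _ _ _ (D x Ux)).
Qed.

(** The difference [f y - f y0] is the integral over [[0, 1]] of the derivative of
    [s |-> f (y0 + s (y - y0))]; the chain rule splits it into coordinates, and [G i] is the
    integral of the [i]-th partial derivative. *)
Lemma hadamard (f : V -> W) : U y0 -> smooth_on U f ->
  exists G : 'I_n -> V -> W, [/\ forall i, smooth_on U (G i),
    forall i, G i y0 = 'D_(delta_mx 0 i) f y0 &
    forall y, U y -> f y = f y0 + \sum_i (y 0 i - y0 0 i) * G i y].
Proof.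
move=> Uy0 sf; exists (fun i => seg_int 0 ('D_(delta_mx 0 i) f)); split=> [i k|i|y Uy].
- by apply: Ck_seg_int; exact: ((sf k.+1).2 _).2.
- rewrite /seg_int -[RHS]int01_cst; apply: eq_int01 => s _.
  by rewrite expr0 mul1r /seg subrr scaler0 addr0.
have cD i x : U x -> {for x, continuous ('D_(delta_mx 0 i) f)}.
  exact: ((sf 1%N).2 _).2.1.
have cs i : cont01 (fun s => 'D_(delta_mx 0 i) f (seg y s)).
  have := seg_cont01 (k := 0%N) (@cD i) Uy; congr cont01; apply/funext => s.
  by rewrite expr0 mul1r.
(* Continuity of the integrand and the exchange of sum and integral are proved together, since
   additivity of the integral asks for continuity. *)
have H (r : seq 'I_n) :
    let F s := \sum_(i <- r) (y 0 i - y0 0 i) * 'D_(delta_mx 0 i) f (seg y s) in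
    cont01 F /\ \sum_(i <- r) (y 0 i - y0 0 i) * seg_int 0 ('D_(delta_mx 0 i) f) y =
      int01 F.
  elim: r => [|i r [IHc IH]] /=.
    rewrite big_nil; under eq_fun do rewrite big_nil.
    by split; [exact: cont01_cst|rewrite int01_cst].
  under eq_fun do rewrite big_cons.
  have ci : cont01 (fun s => (y 0 i - y0 0 i) * 'D_(delta_mx 0 i) f (seg y s)).
    by apply: cont01M => //; exact: cont01_cst.
  split; first exact: cont01D.
  rewrite big_cons IH int01D // int01Z //; congr (_ * _ + _).
  by apply: eq_int01 => s _; rewrite expr0 mul1r.
have [csum ->] := H (index_enum _).
have dF s : 0 <= s <= 1 -> is_derive (s : W) (1 : W) (fun s : W => f (seg y s))
    (\sum_i (y 0 i - y0 0 i) * 'D_(delta_mx 0 i) f (seg y s)).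
  move=> s01; have Us := star Uy s01.
  have [dfs _] := Ck1_differentiable oU (sf 1%N) Us.
  have -> : \sum_i (y 0 i - y0 0 i) * 'D_(delta_mx 0 i) f (seg y s) =
      'D_(y - y0) f (seg y s).
    rewrite (Ck1_derive _ oU (sf 1%N) Us).
    by apply: eq_bigr => i _; rewrite !mxE.
  apply: (derivable_line (f := f) (x := y0) (v := y - y0) (t := s)).
  exact: diff_derivable.
by rewrite (int01_FTC dF csum) /seg scale1r scale0r addr0 !subrKC.
Qed.

End hadamard.

(** * Neighbourhoods and cut-offs on manifolds *)

Section neighbourhoods.
Variables (R : realType) (n : nat) (T : Type) (M : manifold R n T).
Local Notation C := (Cinf M).
Local Notation W := (R : normedModType R).

(** The neighbourhood filter of the topology given by the atlas; as a filter instance it supports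
    [filterS] and [near]. *)
Definition mnbhs (m : T) : set_system T :=
  fun P => exists N, [/\ mopen (atlas M) N, N m & N `<=` P].

Lemma mopenI (N N' : set T) :
  mopen (atlas M) N -> mopen (atlas M) N' -> mopen (atlas M) (N `&` N').
Proof.
move=> oO oO' c Ac; rewrite -[cimg c]setIid preimage_setI setIACA.
by apply: openI; [exact: oO|exact: oO'].
Qed.

Global Instance mnbhs_filter m : ProperFilter (mnbhs m).
Proof.
apply: Build_ProperFilter; first by move=> [N [_ Om /(_ _ Om)]].
split.
- by exists setT; split=> // c Ac; rewrite preimage_setT setIT; exact: cimg_open.
- move=> P Q [N [oO Om OP]] [N' [oO' Om' OQ]]; exists (N `&` N').
  by split=> [|//|x [/OP ? /OQ ?]//]; exact: mopenI.
- by move=> P Q PQ [N [oO Om OP]]; exists N; split=> //; exact: subset_trans PQ.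
Qed.

Lemma mnbhs_forall (I : finType) m (P : I -> T -> Prop) :
  (forall i, mnbhs m (P i)) -> mnbhs m (fun x => forall i, P i x).
Proof. exact: (@filter_forall T I P (mnbhs m) (mnbhs_filter m)). Qed.

Lemma mopen_mnbhs m U : mopen (atlas M) U -> U m -> mnbhs m U.
Proof. by move=> oU Um; exists U; split=> // x. Qed.

Lemma mnbhs_singleton m P : mnbhs m P -> P m.
Proof. by move=> [N [_ Om]]; apply. Qed.

Lemma mnbhs_nbhs m P : mnbhs m P -> mnbhs m (fun m' => mnbhs m' P).
Proof. by move=> [N [oO Om OP]]; exists N; split=> // m' Om'; exists N. Qed.

Lemma open_preimage (p q : nat) (U : set 'rV[R]_p) (f : 'rV[R]_p -> 'rV[R]_q)
    (V : set 'rV[R]_q) : open U -> (forall x, U x -> {for x, continuous f}) ->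
  open V -> open (U `&` f @^-1` V).
Proof.
move=> oU cf oV; rewrite openE => x [Ux Vfx]; apply: filterI.
  exact: open_nbhs_nbhs.
have cfx : f y @[y --> x] --> f x := cf x Ux.
by apply: cfx; exact: open_nbhs_nbhs.
Qed.

Definition chart_set (c : chart R n T) (V : set 'rV[R]_n) : set T :=
  [set x | cdom c x /\ V (cto c x)].

Lemma mopen_chart_set c V : atlas M c -> open V -> mopen (atlas M) (chart_set c V).
Proof.
move=> Ac oV c' Ac'; have [oU sm] := atlas_compat Ac' Ac.
have -> : cimg c' `&` cfrom c' @^-1` chart_set c V =
    (cimg c' `&` cfrom c' @^-1` cdom c) `&` (cto c \o cfrom c') @^-1` V.
  by apply/seteqP; split=> x; [move=> [? []]|move=> [[]]].
by apply: open_preimage => //; exact: (sm 0%N).1.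
Qed.

Lemma smooth_on_chart c c' V (f : 'rV[R]_n -> W) : atlas M c -> atlas M c' ->
  open V -> smooth_on V f ->
  smooth_on (cimg c' `&` cfrom c' @^-1` chart_set c V) (f \o (cto c \o cfrom c')).
Proof.
move=> Ac Ac' oV sf k; have [oU sm] := atlas_compat Ac' Ac.
apply: (@Ck_comp _ _ _ _ _ V) => //; first exact: mopen_chart_set.
  by move=> x [_ []].
move=> i; apply: smooth_coord; first exact: mopen_chart_set.
by apply: Ck_sub (sm k) => x [? []].
Qed.

Lemma smooth_localP (h : T -> R) :
  (forall m, exists N, [/\ mopen (atlas M) N, N m & forall c, atlas M c ->
     smooth_on (cimg c `&` cfrom c @^-1` N) (h \o cfrom c : _ -> W)]) ->
  smooth M h.
Proof.
move=> hl c Ac k; apply: Ck_local => x cx; have [N [oO Om sO]] := hl (cfrom c x).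
by exists (cimg c `&` cfrom c @^-1` N); split=> //; exact: sO.
Qed.

(** The usual way to prove smoothness below: near each point the function is compared with a
    globally defined smooth one, so that no chart has to be unfolded. *)
Lemma smooth_near_eq (h : T -> R) :
  (forall m, exists g : C, mnbhs m (fun m' => h m' = g m')) -> smooth_pred M h.
Proof.
move=> hl; apply/asboolP; apply: smooth_localP => m.
have [g [N [oO Om Oh]]] := hl m; exists N; split=> // c Ac k.
apply: (@Ck_eq _ _ _ _ _ (g \o cfrom c)); first exact: oO.
  by move=> x [_ /Oh].
have /asboolP gs := cinf_smooth g; apply: Ck_sub (gs c Ac k) => x [].
by [].
Qed.

Lemma cfrom_nbhs c m P : atlas M c -> cdom c m -> mnbhs m P ->
  \forall x \near cto c m, cimg c x /\ P (cfrom c x).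
Proof.
move=> Ac cm [N [oO Om OP]]; have [im fm] := ctoK cm.
have := oO c Ac; rewrite openE => /(_ (cto c m)) H.
have := H (conj im _); rewrite /= fm => /(_ Om).
by apply: filterS => x [cx /OP].
Qed.

(** Here the Hausdorff axiom enters: [m] is separated from each point of the compact image, and
    compactness leaves one neighbourhood of [m]. It ensures that a cut-off supported in a chart
    stays smooth when extended by zero. *)
Lemma cfrom_compact_closed c (K : set 'rV[R]_n) m : atlas M c -> compact K ->
  K `<=` cimg c -> ~ (cfrom c @` K) m -> mnbhs m (fun m' => ~ (cfrom c @` K) m').
Proof.
move=> Ac cK Kc mK.
have /(_ _ (mnbhs m) (fun m' y => m' <> cfrom c y) _) :=
  iffLR (compact_near_coveringP K) cK.
move=> H; suff : \forall m' \near mnbhs m, K `<=` (fun y => m' <> cfrom c y).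
  by apply: filterS => m' h [y Ky E]; apply: (h y Ky).
apply: H => y Ky.
have mny : m <> cfrom c y by move=> E; apply: mK; exists y.
have [U [V [oU oV Um Vy UV]]] := @mhausdorff _ _ _ M _ _ mny.
exists ((cimg c `&` cfrom c @^-1` V), U) => /=.
  split; last by rewrite nbhs_simpl; exact: mopen_mnbhs.
  by apply: open_nbhs_nbhs; split; [exact: oV|split=> //; exact: Kc].
move=> [y' m'] /= [[_ Vy'] Um'] E; have : (U `&` V) m' by split=> //; rewrite E.
by rewrite UV.
Qed.

(** The final dichotomy is what extension by zero requires: at each point either the chart formula
    is available, or [chi] vanishes on a whole neighbourhood. *)
Lemma exists_cutoff c V m : atlas M c -> open V -> V `<=` cimg c ->
  chart_set c V m ->
  exists chi : C, mnbhs m (fun m' => chi m' = 1) /\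
    forall m', chart_set c V m' \/ mnbhs m' (fun x => chi x = 0).
Proof.
move=> Ac oV Vc [cm Vm]; set y0 := cto c m.
have /nbhs_ballP[d /= d0 dV] : nbhs y0 V by exact: open_nbhs_nbhs.
(* Half the radius, so that the closed cube [K] containing the support of [b] still lies in the open
   ball inside [V]. *)
pose e := d / 2; have e0 : 0 < e by rewrite divr_gt0.
have [b [Cb b1 bK]] := exists_bump y0 e0.
pose K : set 'rV[R]_n := [set v | forall i, v 0 i \in `[y0 0 i - e, y0 0 i + e]].
have cK : compact K.
  exact: (@rV_compact R n (fun i => [set` `[y0 0 i - e, y0 0 i + e]])
    (fun i => @segment_compact _ _ _)).
have KV : K `<=` V.
  move=> v Kv; apply: dV; rewrite -ball_normE /ball_ /=.
  apply: (@le_lt_trans _ _ e); last by rewrite /e ltr_pdivrMr // ltr_pMr // ltr1n.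
  apply: norm_rV_le => [|i]; first exact: ltW.
  by have := Kv i; rewrite !mxE distrC ler_distl in_itv.
have bKK y : b y != 0 -> K y.
  move=> /bK h i; rewrite in_itv /= -ler_distl.
  by have := le_trans (coord_le_norm _ i) h; rewrite !mxE.
pose h (x : T) : R := if `[< chart_set c V x >] then b (cto c x) else 0.
have hout x : ~ chart_set c V x -> mnbhs x (fun x => h x = 0).
  move=> nx; have : ~ (cfrom c @` K) x.
    move=> [y Ky E]; apply: nx; rewrite -E.
    have [cy yE] := cfromK (Vc _ (KV _ Ky)).
    by split; rewrite ?yE //; exact: KV.
  move=> /(cfrom_compact_closed Ac cK (subset_trans KV Vc)).
  apply: filterS => x' nK; rewrite /h; case: ifPn => // /asboolP [cx' Vx'].
  have [//|/bKK Kx'] := eqVneq (b (cto c x')) 0.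
  by case: nK; exists (cto c x') => //; have [] := ctoK cx'.
have sh : smooth M h.
  apply: smooth_localP => x; have [xV|/hout] := pselect (chart_set c V x).
    exists (chart_set c V); split=> //; first exact: mopen_chart_set.
    move=> c' Ac' k.
    have sb : smooth_on V b by move=> l; exact: Cb.
    apply: Ck_eq (smooth_on_chart Ac Ac' oV sb k); first exact: mopen_chart_set.
    by move=> y [_ Vy]; rewrite /h /= ifT //; exact/asboolP.
  move=> [N [oO Ox Oh]]; exists N; split=> // c' Ac' k.
  apply: (Ck_eq _ _ (Ck_cst _ _ (0 : W))); first exact: oO.
  by move=> y [_ /Oh /= ->].
exists (MkCinf M h (asboolT sh)); split=> [|x].
  exists (chart_set c (V `&` interior [set y | b y = 1])); split.
  - by apply: mopen_chart_set => //; apply: openI => //; exact: open_interior.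
  - by split.
  - move=> x [cx [Vx /interior_subset bx]] /=.
    by rewrite /h ifT //; apply/asboolP.
by have [?|/hout] := pselect (chart_set c V x); [left|right].
Qed.

Lemma chart_extension c V m (f : 'rV[R]_n -> W) : atlas M c -> open V ->
  V `<=` cimg c -> chart_set c V m -> smooth_on V f ->
  exists g : C, mnbhs m (fun m' => g m' = f (cto c m')).
Proof.
move=> Ac oV Vc mV sf; have [chi [chi1 chi0]] := exists_cutoff Ac oV Vc mV.
pose h (x : T) : R := if `[< chart_set c V x >] then chi x * f (cto c x) else 0.
have sh : smooth M h.
  apply: smooth_localP => x; have [xV|[N [oO Ox Oh]]] := chi0 x.
    exists (chart_set c V); split=> //; first exact: mopen_chart_set.
    move=> c' Ac' k.
    have oU := mopen_chart_set Ac oV Ac'.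
    have /asboolP schi := cinf_smooth chi.
    have Cc := Ck_sub (@subIsetl _ _ _) (schi c' Ac' k).
    have Cp := CkM oU (Cc _) (smooth_on_chart Ac Ac' oV sf k).
    apply: (Ck_eq oU _ Cp).
    by move=> y [_ Vy]; rewrite /h /= ifT //; exact/asboolP.
  exists N; split=> // c' Ac' k.
  apply: (Ck_eq _ _ (Ck_cst _ _ (0 : W))); first exact: oO.
  by move=> y [_ /Oh /= E]; rewrite /h; case: ifP; rewrite ?E ?mul0r.
exists (MkCinf M h (asboolT sh)).
have : mnbhs m (chart_set c V) by apply: mopen_mnbhs => //; exact: mopen_chart_set.
apply: filterS2 chi1 => x E Vx /=.
by rewrite /h E mul1r ifT //; exact/asboolP.
Qed.

Lemma mnbhs_cdom c m : atlas M c -> cdom c m -> mnbhs m (cdom c).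
Proof.
move=> Ac cm; exists (chart_set c (cimg c)); split.
- exact: mopen_chart_set (@cimg_open _ _ _ _).
- by split=> //; have [] := ctoK cm.
- by move=> x [].
Qed.

Lemma mnbhs_bump m P : mnbhs m P ->
  exists chi : C, chi m = 1 /\ forall x, chi x != 0 -> P x.
Proof.
move=> [N [oO Om OP]]; have [c Ac cm] := atlas_cover M m.
have [im fm] := ctoK cm.
have mV : chart_set c (cimg c `&` cfrom c @^-1` N) m by do 2 split=> //=; rewrite fm.
have [chi [chi1 chi0]] := exists_cutoff Ac (oO c Ac) (@subIsetl _ _ _) mV.
exists chi; split; first exact: (mnbhs_singleton chi1).
move=> x chix; have [[cx [_ /=]]|/mnbhs_singleton /= E] := chi0 x.
  by have [_ ->] := ctoK cx; exact: OP.
by rewrite E eqxx in chix.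
Qed.

Lemma smooth_neq0_mnbhs (f : C) m : f m != 0 -> mnbhs m (fun x => f x != 0).
Proof.
move=> fm; apply: mopen_mnbhs => // c Ac.
have /asboolP sf := cinf_smooth f.
rewrite openE => x [cx fx]; apply: filterI.
  by apply: open_nbhs_nbhs; split=> //; exact: cimg_open.
have cfx : (f \o cfrom c) y @[y --> x] --> (f \o cfrom c) x := (sf c Ac 0%N).1 x cx.
by move/cvgr_neq0 : cfx; exact.
Qed.

End neighbourhoods.

(** * Tangent vectors and coordinate frames *)

Section tangent_theory.
Variables (R : realType) (n : nat) (T : Type) (M : manifold R n T).
Local Notation C := (Cinf M).
Local Notation W := (R : normedModType R).

Lemma cinf_eq (f g : C) : (forall m, f m = g m) -> f = g.
Proof. by move=> fg; apply: val_inj; apply/funext. Qed.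

Lemma cinf_sumE (I : Type) (r : seq I) (F : I -> C) m :
  (\sum_(i <- r) F i) m = \sum_(i <- r) F i m.
Proof. by apply: (big_morph (fun f : C => f m)). Qed.

(** Turns equality near a point into a global algebraic identity, to which a Leibniz rule can be
    applied. This is how abstract derivations are seen to be local. *)
Lemma cinf_near_eq0 m (f g : C) : mnbhs M m (fun x => f x = g x) ->
  exists chi : C, chi m = 1 /\ chi * (f - g) = 0.
Proof.
move=> fg; have [chi [chi1 chiP]] := mnbhs_bump fg; exists chi; split=> //.
apply: cinf_eq => x; rewrite -[LHS]/(chi x * (f x - g x)).
by have [->|/chiP ->] := eqVneq (chi x) 0; rewrite ?mul0r // subrr mulr0.
Qed.

Section tangent_algebra.
Variables (m : T) (t : tangent M m).

Lemma tangentM (f g : C) : t (f * g) = f m * t g + g m * t f.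
Proof. by case: t => u /= /asboolP[_ ->]. Qed.

Lemma tangent0 : t 0 = 0.
Proof. by apply: (addrI (t 0)); rewrite -tangentD !addr0. Qed.

Lemma tangent_sum (I : Type) (r : seq I) (F : I -> C) :
  t (\sum_(i <- r) F i) = \sum_(i <- r) t (F i).
Proof. by apply: (big_morph t); [exact: tangentD|exact: tangent0]. Qed.

Lemma tangent_cst a : t (Ccst M a) = 0.
Proof.
have t1 : t 1 = 0.
  by apply: (addrI (t 1)); rewrite addr0 -[in RHS](mulr1 1) tangentM mul1r.
have : t (Ccst M a * 1 + 0) = a * t 1 + t 0.
  by case: t => u /= /asboolP[-> _].
by rewrite addr0 mulr1 t1 tangent0 mulr0 addr0.
Qed.

Lemma tangentN f : t (- f) = - t f.
Proof. by apply: (addrI (t f)); rewrite -tangentD !subrr tangent0. Qed.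

Lemma tangent_local (f g : C) : mnbhs M m (fun x => f x = g x) -> t f = t g.
Proof.
move=> fg; have [chi [chi1 E]] := cinf_near_eq0 fg.
have := tangentM chi (f - g); rewrite E tangent0 chi1 mul1r.
have -> : (f - g) m = 0.
  by rewrite -[LHS]/(f m - g m) (mnbhs_singleton fg) subrr.
by rewrite mul0r addr0 tangentD tangentN => /esym/subr0_eq.
Qed.

End tangent_algebra.

Lemma vfield_local (X : vfield M) m (f g : C) :
  mnbhs M m (fun x => f x = g x) -> X f m = X g m.
Proof. exact: (@tangent_local m (vfield_at X m)). Qed.

Lemma cfrom_smooth c (f : C) : atlas M c -> smooth_on (cimg c) (f \o cfrom c : _ -> W).
Proof. by move=> Ac; have /asboolP := cinf_smooth f; exact. Qed.

(** The coordinate field multiplied by a cut-off and extended by zero. *)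
Lemma chart_vfield c m i : atlas M c -> cdom c m ->
  exists X : vfield M, mnbhs M m (fun x => forall f : C,
    X f x = 'D_(delta_mx 0 i) (f \o cfrom c : _ -> W) (cto c x)).
Proof.
move=> Ac cm; have [im fm] := ctoK cm.
have oc := @cimg_open _ _ _ c.
have mV : chart_set c (cimg c) m by [].
have [chi [chi1 chi0]] := exists_cutoff Ac oc (@subset_refl _ _) mV.
pose h (f : C) (x : T) : R := if `[< chart_set c (cimg c) x >] then
  chi x * 'D_(delta_mx 0 i) (f \o cfrom c : _ -> W) (cto c x) else 0.
have sh f : smooth_pred M (h f).
  apply: smooth_near_eq => x; have [xV|x0] := chi0 x.
    have sD : smooth_on (cimg c) ('D_(delta_mx 0 i) (f \o cfrom c : _ -> W)).
      by move=> k; exact: ((cfrom_smooth f Ac k.+1).2 _).2.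
    have [g gE] := chart_extension Ac oc (@subset_refl _ _) xV sD.
    exists (chi * g).
    have N : mnbhs M x (chart_set c (cimg c)).
      by apply: mopen_mnbhs => //; exact: mopen_chart_set.
    apply: filterS2 gE N => x' gE' xV'.
    by rewrite /h ifT; [rewrite -gE'|exact/asboolP].
  exists 0; apply: filterS x0 => x' E.
  by rewrite /h E mul0r if_same.
pose X (f : C) : C := MkCinf M (h f) (sh f).
have dv (f : C) x : chart_set c (cimg c) x ->
    derivable (f \o cfrom c : _ -> W) (cto c x) (delta_mx 0 i).
  by move=> [_ cx]; apply: ((cfrom_smooth f Ac 1).2 _).1.
have Xp : vfield_pred (X : C -> (C^o)%type).
  apply/asboolP; split=> [a f g|f g]; apply: cinf_eq => x.
    rewrite -[RHS]/(a * h f x + h g x) /= /h.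
    case: ifP => [/asboolP xV|_]; last by rewrite mulr0 addr0.
    rewrite -[_ \o _]/(cst a * (f \o cfrom c) + (g \o cfrom c)).
    have df := dv f x xV; have dg := dv g x xV.
    have dc : derivable (cst a : 'rV[R]_n -> W) (cto c x) (delta_mx 0 i) by exact: derivable_cst.
    rewrite deriveD //; last exact: derivableM.
    rewrite deriveM // derive_cst scaler0 addr0 /GRing.scale /=; ring.
  rewrite -[RHS]/(f x * h g x + g x * h f x) /= /h.
  case: ifP => [/asboolP xV|_]; last by rewrite !mulr0 addr0.
  rewrite -[_ \o _]/((f \o cfrom c) * (g \o cfrom c)).
  rewrite deriveM; try exact: dv.
  by rewrite /GRing.scale /= (ctoK xV.1).2; ring.
exists (MkVfield Xp).
have N : mnbhs M m (chart_set c (cimg c)).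
  by apply: mopen_mnbhs => //; exact: mopen_chart_set.
apply: filterS2 chi1 N => x E xV f.
by rewrite /= /h E mul1r ifT //; exact/asboolP.
Qed.

Lemma ball_star (y z : 'rV[R]_n) r (s : R) : ball y r z -> 0 <= s <= 1 ->
  ball y r (y + s *: (z - y)).
Proof.
rewrite -ball_normE /ball_ /= => yz /andP[s0 s1].
rewrite opprD addNKr normrN normrZ (ger0_norm s0).
by apply: le_lt_trans yz; rewrite distrC ler_piMl.
Qed.

(** For the last clause, Hadamard's lemma writes [F] near [m] as [F m + sum_i (f i - f i m) g i]
    with [g i m = X i F m]. A derivation at [m] kills the constants, and in each product only
    [t (f i) * g i m] survives. *)
Lemma chart_frame c m0 : atlas M c -> cdom c m0 ->
  exists (f : 'I_n -> C) (X : 'I_n -> vfield M), mnbhs M m0 (fun m =>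
    [/\ cdom c m, forall i, f i m = cto c m 0 i,
        forall i j, X i (f j) m = (i == j)%:R &
        forall (t : tangent M m) (F : C), t F = \sum_i t (f i) * X i F m]).
Proof.
move=> Ac cm; have [im fm] := ctoK cm.
have oc := @cimg_open _ _ _ c.
have mV : chart_set c (cimg c) m0 by [].
have /choice [f fE] i : exists g : C, mnbhs M m0 (fun m => g m = cto c m 0 i).
  exact: (chart_extension (f := fun y : 'rV[R]_n => y 0 i : W) Ac oc
    (@subset_refl _ _) mV (fun k => Ck_coord k _ i)).
have /choice [X XE] i : exists X : vfield M, mnbhs M m0 (fun x => forall f : C,
    X f x = 'D_(delta_mx 0 i) (f \o cfrom c : _ -> W) (cto c x)).
  exact: chart_vfield.
exists f, X.
have Nf : mnbhs M m0 (fun m => forall i, f i m = cto c m 0 i).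
  exact: mnbhs_forall.
have NX : mnbhs M m0 (fun x => forall i (f : C),
    X i f x = 'D_(delta_mx 0 i) (f \o cfrom c : _ -> W) (cto c x)).
  exact: mnbhs_forall.
(* Differentiating [f i] at [m] uses its coordinate expression around [m], not only at [m]; hence
   [mnbhs_nbhs]. *)
apply: filterS3 (mnbhs_nbhs Nf) NX (mnbhs_cdom Ac cm) => m Nfm Xm dm.
have fm' := mnbhs_singleton Nfm.
split=> // [i j|t F].
  rewrite Xm.
  have N := cfrom_nbhs Ac dm Nfm.
  rewrite (near_eq_derive (g := fun y : 'rV[R]_n => y 0 j : W)).
    rewrite (@derive_val _ _ _ _ _ _ _ (is_derive_coord _ _ j)) mxE eqxx /=.
    by rewrite eq_sym.
  by apply: filterS N => y [cy /(_ j)]; rewrite /= (cfromK cy).2.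
have [iy fy] := ctoK dm; set y := cto c m.
(* A ball is star-shaped about its centre, as Hadamard's lemma demands; the chart image may not
   be. *)
have /nbhs_ballP[r /= r0 rV] : nbhs y (cimg c) by exact: open_nbhs_nbhs.
have oB : open (ball y r).
  exact: (@ball_open _ ('rV[R]_n : normedModType R)).
have sF : smooth_on (ball y r) (F \o cfrom c : _ -> W).
  by move=> k; apply: Ck_sub (cfrom_smooth F Ac k).
have [G [sG Gy GE]] := hadamard oB (fun z s => @ball_star y z r s) (ballxx _ r0) sF.
have mB : chart_set c (ball y r) m by split=> //; exact: ballxx.
have /choice [g gE] i : exists g : C, mnbhs M m (fun m' => g m' = G i (cto c m')).
  exact: (chart_extension Ac oB rV mB).
have Ng : mnbhs M m (fun m' => forall i, g i m' = G i (cto c m')).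
  exact: mnbhs_forall.
have NB : mnbhs M m (chart_set c (ball y r)).
  by apply: mopen_mnbhs => //; exact: mopen_chart_set.
rewrite (@tangent_local _ t F
  (Ccst M (F m) + \sum_i (f i - Ccst M (y 0 i)) * g i)); last first.
  apply: filterS3 Nfm Ng NB => m' f' g' [cm' Bm'].
  have := GE _ Bm'; rewrite /= (ctoK cm').2 fy => ->.
  rewrite -[RHS]/(F m + (\sum_i (f i - Ccst M (y 0 i)) * g i) m') cinf_sumE.
  congr (_ + _); apply: eq_bigr => i _.
  by rewrite -[RHS]/((f i m' - y 0 i) * g i m') f' g'.
rewrite tangentD tangent_cst add0r tangent_sum; apply: eq_bigr => i _.
rewrite tangentM tangentD tangentN tangent_cst subr0.
have -> : (f i - Ccst M (y 0 i)) m = 0.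
  by rewrite -[LHS]/(f i m - y 0 i) fm' subrr.
rewrite mul0r add0r mulrC.
by rewrite (mnbhs_singleton (gE i)) Gy Xm.
Qed.

End tangent_theory.

(** * Frames of a vector bundle *)

Section bundle_frames.
Variables (R : realType) (n r : nat) (T : Type) (M : manifold R n T).
Variables (fib : T -> lmodType R) (E : vbundle r M fib).
Local Notation TE := (Defs.total E).
Local Notation C := (Cinf M).
Local Notation W := (R : normedModType R).
Local Notation pt := (existT (fun m => fib m : Type)).
Local Notation pb := (pullback E).
Local Notation ev eps m e := ((eps m : lhom _ _) e).

(** Smoothness of the projection is given through pulled back functions, so its continuity is read
    off from the pullback of a bump function supported in [P]. *)
Lemma mnbhs_pullback (p : {m : T & fib m}) P :
  mnbhs M (projT1 p) P -> mnbhs TE p (fun p' => P (projT1 p')).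
Proof.
move=> Pp; have [chi [chi1 chiP]] := mnbhs_bump Pp.
have : pb chi p != 0 by rewrite [_ p]chi1 oner_neq0.
by move=> chip; apply: filterS (smooth_neq0_mnbhs chip) => p' /chiP.
Qed.

Section trivialization.
Variables (c : chart R n T) (tr : forall m, fib m -> 'rV[R]_r)
  (tc : chart R (n + r) {m : T & fib m}).
Hypotheses (Ac : atlas M c) (Atc : atlas TE tc)
  (trP : forall m, cdom c m -> linear (@tr m) /\ bijective (@tr m))
  (tc_dom : cdom tc = [set p | cdom c (projT1 p)])
  (tcE : forall m e, cdom c m -> cto tc (pt m e) = row_mx (cto c m) (tr e)).

Lemma cfrom_tcE m (e : fib m) : cdom c m -> cfrom tc (row_mx (cto c m) (tr e)) = pt m e.
Proof.
move=> cm; rewrite -tcE //.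
by have [|_ ->] := @ctoK _ _ _ tc (pt m e); rewrite ?tc_dom.
Qed.

Lemma cimg_tc x v : cimg c x -> cimg tc (row_mx x v).
Proof.
move=> cx; have [cm xE] := cfromK cx; have [_ [g gK1 gK2]] := trP cm.
rewrite -xE -(gK2 v) -tcE //.
by have [] := @ctoK _ _ _ tc (pt (cfrom c x) (g v)); rewrite ?tc_dom.
Qed.

(** [F] along the local section with components [w]: in charts this is the composition of [F] with
    [x |-> (x, w x)]. *)
Lemma triv_smooth (F : Cinf TE) (w : 'I_r -> C) m : cdom c m ->
  exists g : C, mnbhs M m (fun m' =>
    g m' = F (cfrom tc (row_mx (cto c m') (\row_j w j m')))).
Proof.
move=> cm; have [im fm] := ctoK cm.
pose k (x : 'rV[R]_n) : 'rV[R]_(n + r) := row_mx x (\row_j w j (cfrom c x)).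
have sk : smooth_on (cimg c) ((F \o cfrom tc) \o k : _ -> W).
  move=> l; apply: (@Ck_comp _ _ _ _ _ (cimg tc)).
  - exact: cimg_open.
  - exact: cimg_open.
  - by move=> x cx; exact: cimg_tc.
  - move=> i; rewrite /k; case: (splitP i) => j ij.
      apply: (@Ck_eq _ _ _ _ _ (fun x => x 0 j : W)); [exact: cimg_open| |exact: Ck_coord].
      by move=> x _; rewrite (_ : i = lshift r j) ?row_mxEl //; exact: val_inj.
    apply: (@Ck_eq _ _ _ _ _ (w j \o cfrom c)); [exact: cimg_open| |].
      by move=> x _; rewrite (_ : i = rshift n j) ?row_mxEr ?mxE //; exact: val_inj.
    exact: (cfrom_smooth (w j) Ac).
  - exact: (cfrom_smooth F Atc).
have mV : chart_set c (cimg c) m by [].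
have [g gE] := chart_extension Ac (@cimg_open _ _ _ c) (@subset_refl _ _) mV sk.
exists g; have N := mnbhs_cdom Ac cm.
by apply: filterS2 gE N => m' -> cm'; rewrite /k /= (ctoK cm').2.
Qed.

Lemma dual_frame m0 : cdom c m0 -> exists eps : 'I_r -> dsec E,
  mnbhs M m0 (fun m => cdom c m /\ forall j e, ev (eps j) m e = tr e 0 j).
Proof.
move=> cm0; have [im fm] := ctoK cm0.
have mV : chart_set c (cimg c) m0 by [].
have [chi [chi1 chi0]] :=
  exists_cutoff Ac (@cimg_open _ _ _ c) (@subset_refl _ _) mV.
pose h j m (e : fib m) : R^o := if `[< cdom c m >] then chi m * tr e 0 j else 0.
have lh j m : lin_pred (@h j m).
  apply/asboolP => a u v; rewrite /h; case: ifP => [/asboolP cm|_].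
    by rewrite (trP cm).1 !mxE /GRing.scale /=; ring.
  by rewrite scaler0 addr0.
pose eps j m : dualfib fib m := MkLhom (lh j m).
have se j : smooth_pred TE (ell_fun (eps j)).
  apply: smooth_near_eq => p; have [[cp ip]|x0] := chi0 (projT1 p).
    have ptc : cdom tc p by rewrite tc_dom.
    have pV : chart_set tc (cimg tc) p by split=> //; have [] := ctoK ptc.
    (* Near [p] the linear function of [eps j] is the pullback of [chi] times the [j]-th fibre
       coordinate of the bundle chart. *)
    have [g gE] := chart_extension (f := fun y : 'rV[R]_(n + r) => y 0 (rshift n j) : W)
      Atc (@cimg_open _ _ _ tc) (@subset_refl _ _) pV (fun k => Ck_coord k _ _).
    exists (pb chi * g).
    have N := mnbhs_pullback (mnbhs_cdom Ac cp).
    apply: filterS2 gE N => -[m e] gE /= cm.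
    rewrite -[RHS]/(chi m * g (pt m e)) gE tcE // row_mxEr /ell_fun /= /h ifT //.
    exact/asboolP.
  exists 0; apply: filterS (mnbhs_pullback x0) => -[m e] /= E0.
  by rewrite /ell_fun /= /h E0 mul0r if_same.
exists (fun j => MkDsec (se j)).
apply: filterS2 chi1 (mnbhs_cdom Ac cm0) => m E1 cm; split=> // j e.
by rewrite /= /h E1 mul1r ifT //; exact/asboolP.
Qed.

End trivialization.

(** In a trivialization [F] along [s] depends smoothly on the components of [s], and these are
    pairings with a dual frame. So it suffices to test linear functions in place of all smooth
    functions on [E]. *)
Lemma sec_smoothP (s : forall m, fib m) :
  (forall eps : dsec E, smooth_pred M (fun m => ev eps m (s m))) ->
  forall F : Cinf TE, smooth M (fun m => F (pt m (s m))).
Proof.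
move=> ss F; apply/asboolP; apply: smooth_near_eq => m.
have [c [tr [tc [Ac cm Atc trP [tc_dom tcE]]]]] := loc_triv E m.
have [eps epsE] := dual_frame Ac Atc trP tc_dom tcE cm.
pose w j : C := MkCinf M _ (ss (eps j)).
have [g gE] := triv_smooth Ac Atc trP tc_dom tcE F w cm.
exists g; apply: filterS2 gE epsE => m' -> [cm' E'].
have -> : \row_j w j m' = tr m' (s m') by apply/rowP => j; rewrite mxE /= E'.
by rewrite (cfrom_tcE tc_dom tcE).
Qed.

(** The preimages of basis vectors, cut off by [chi]. They are chosen point by point; smoothness is
    tested on dual sections, where [triv_smooth] applies with constant components. *)
Lemma sec_frame c (tr : forall m, fib m -> 'rV[R]_r) tc m0 :
  atlas M c -> atlas TE tc ->
  (forall m, cdom c m -> linear (tr m) /\ bijective (tr m)) ->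
  cdom tc = [set p | cdom c (projT1 p)] ->
  (forall m e, cdom c m -> cto tc (pt m e) = row_mx (cto c m) (tr m e)) ->
  cdom c m0 ->
  exists s : 'I_r -> sec E, mnbhs M m0 (fun m => forall j, tr m (s j m) = delta_mx 0 j).
Proof.
move=> Ac Atc trP tc_dom tcE cm0; have [im fm] := ctoK cm0.
have mV : chart_set c (cimg c) m0 by [].
have [chi [chi1 chi0]] :=
  exists_cutoff Ac (@cimg_open _ _ _ c) (@subset_refl _ _) mV.
have H j m : exists e : fib m, cdom c m -> tr m e = delta_mx 0 j.
  have [cm'|ncm] := pselect (cdom c m); last by exists 0.
  by have [_ [g _ gK]] := trP m cm'; exists (g (delta_mx 0 j)).
pose s0 j m := projT1 (cid (H j m)).
have s0P j m : cdom c m -> tr m (s0 j m) = delta_mx 0 j := projT2 (cid (H j m)).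
pose s j m := chi m *: s0 j m.
have hs j (eps : dsec E) : smooth_pred M (fun m => ev eps m (s j m)).
  apply: smooth_near_eq => m; have [[cm im']|x0] := chi0 m.
    have [g gE] := triv_smooth Ac Atc trP tc_dom tcE (ell eps)
      (fun k => Ccst M ((delta_mx 0 j : 'rV_r) 0 k)) cm.
    exists (chi * g); apply: filterS2 gE (mnbhs_cdom Ac cm) => m' gE cm'.
    rewrite -[RHS]/(chi m' * g m') gE linearZ.
    rewrite (_ : \row_k _ = tr m' (s0 j m')) ?(cfrom_tcE tc_dom tcE) //.
    by rewrite s0P //; apply/rowP => k; rewrite !mxE.
  exists 0; apply: filterS x0 => m' E0.
  by rewrite /s E0 scale0r linear0.
exists (fun j => MkSec (sec_smoothP (hs j))).
apply: filterS2 chi1 (mnbhs_cdom Ac cm0) => m E1 cm j.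
by rewrite /= /s E1 scale1r s0P.
Qed.

(** [Y] and [Z] are the coordinate fields of [E] in the base and fibre directions, for the
    coordinates [pb (f i)] and [ell (eps j)]. They are cut off around one point of [E] and so depend
    on [e0], while the frames over [M] serve the whole fibre. *)
Lemma bundle_frame m0 :
  exists (f : 'I_n -> C) (X : 'I_n -> vfield M)
         (eps : 'I_r -> dsec E) (s : 'I_r -> sec E),
    mnbhs M m0 (fun m => [/\ forall i j, X i (f j) m = (i == j)%:R,
      forall (t : tangent M m) (F : C), t F = \sum_i t (f i) * X i F m &
      forall e : fib m, e = \sum_j ev (eps j) m e *: s j m]) /\
    forall e0 : fib m0, exists (Y : 'I_n -> vfield TE) (Z : 'I_r -> vfield TE),
      mnbhs TE (pt m0 e0) (fun p => [/\
        forall i j, Y i (pb (f j)) p = (i == j)%:R,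
        forall i j, Y i (ell (eps j)) p = 0,
        forall i j, Z i (pb (f j)) p = 0,
        forall i j, Z i (ell (eps j)) p = (i == j)%:R &
        forall (t : tangent TE p) (F : Cinf TE), t F =
          \sum_i t (pb (f i)) * Y i F p + \sum_j t (ell (eps j)) * Z j F p]).
Proof.
have [c [tr [tc [Ac cm Atc trP [tc_dom tcE]]]]] := loc_triv E m0.
have [eps epsE] := dual_frame Ac Atc trP tc_dom tcE cm.
have [f [X fX]] := chart_frame Ac cm.
have [s sE] := sec_frame Ac Atc trP tc_dom tcE cm.
exists f, X, eps, s; split.
  apply: filterS3 fX epsE sE => m [cm' _ XfE tE] [_ epsm] sm; split=> // e.
  have [lin [g gK _]] := trP m cm'; apply: (can_inj gK).
  have trD x y : tr m (x + y) = tr m x + tr m y.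
    by have := lin 1 x y; rewrite !scale1r.
  have tr0 : tr m 0 = 0 by apply: (addrI (tr m 0)); rewrite -trD !addr0.
  have trZ a x : tr m (a *: x) = a *: tr m x by rewrite -[a *: x]addr0 lin tr0 addr0.
  rewrite (big_morph (tr m) trD tr0) [LHS]row_sum_delta.
  by apply: eq_bigr => j _; rewrite trZ sm epsm.
move=> e0; have ctc : cdom tc (pt m0 e0) by rewrite tc_dom.
(* The frame of [TE] is the coordinate frame of the bundle chart, its first [n] coordinates coming
   from [M]. *)
have [g [X' gX']] := chart_frame Atc ctc.
exists (fun i => X' (lshift r i)), (fun j => X' (rshift n j)).
have gf : mnbhs TE (pt m0 e0) (fun p => (forall i, pb (f i) p = g (lshift r i) p) /\
    (forall j, ell (eps j) p = g (rshift n j) p)).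
  apply: filterS3 gX' (mnbhs_pullback (p := pt m0 e0) fX)
    (mnbhs_pullback (p := pt m0 e0) epsE).
  move=> [m e] [_ gE _ _] [cm' fE _ _] [_ epsm]; split=> i; rewrite gE tcE //.
    by rewrite row_mxEl -fE.
  by rewrite row_mxEr -epsm.
apply: filterS2 gX' (mnbhs_nbhs gf) => p [_ _ gd tE] gf'.
have gfl i : mnbhs TE p (fun p => pb (f i) p = g (lshift r i) p).
  by apply: filterS gf' => p' [].
have gfr i : mnbhs TE p (fun p => ell (eps i) p = g (rshift n i) p).
  by apply: filterS gf' => p' [].
split=> [i j|i j|i j|i j|t F].
- by rewrite (vfield_local _ (gfl j)) gd (inj_eq (@lshift_inj _ _)).
- by rewrite (vfield_local _ (gfr j)) gd eq_lrshift.
- by rewrite (vfield_local _ (gfl j)) gd eq_rlshift.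
- by rewrite (vfield_local _ (gfr j)) gd (inj_eq (@rshift_inj _ _)).
rewrite tE big_split_ord /=; congr (_ + _); apply: eq_bigr => i _.
  by rewrite (tangent_local _ (gfl i)).
by rewrite (tangent_local _ (gfr i)).
Qed.

End bundle_frames.

(** * Derivations of the dual bundle *)

Lemma theP (T : Type) (x0 : T) (P : T -> Prop) : (exists x, P x) -> P (the x0 P).
Proof. by move=> h; rewrite /the; case: pselect => // h'; exact: projT2 (cid h'). Qed.

Lemma the_eq (T : Type) (x0 y : T) (P : T -> Prop) :
  P y -> (forall x, P x -> x = y) -> the x0 P = y.
Proof. by move=> Py; apply; apply: theP; exists y. Qed.

(** * Extension and gluing of vector fields *)

Section vector_fields.
Variables (R : realType) (n : nat) (T : Type) (M : manifold R n T).
Local Notation C := (Cinf M).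

Lemma vfield_eq (X Y : vfield M) : (forall f m, X f m = Y f m) -> X = Y.
Proof.
move=> XY; apply: val_inj; apply/funext => f; apply: cinf_eq => m; exact: XY.
Qed.

Lemma tangent_eq m (t u : tangent M m) : (forall f, t f = u f) -> t = u.
Proof. by move=> tu; apply: val_inj; apply/funext. Qed.

Lemma vfield_sumE (I : Type) (s : seq I) (g : I -> C) (X : I -> vfield M) f m :
  (\sum_(i <- s) g i *: X i) f m = \sum_(i <- s) g i m * X i f m.
Proof. by apply: (big_morph (fun X : vfield M => X f m)). Qed.

Lemma tangent_sumE m (I : Type) (s : seq I) (a : I -> R) (t : I -> tangent M m) f :
  (\sum_(i <- s) a i *: t i) f = \sum_(i <- s) a i * t i f.
Proof. by apply: (big_morph (fun t : tangent M m => t f)). Qed.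

Lemma tangent_extend m (t : tangent M m) : exists X : vfield M, vfield_at X m = t.
Proof.
have [c Ac cm] := atlas_cover M m.
have [f [X fX]] := chart_frame Ac cm.
have [_ _ _ tE] := mnbhs_singleton fX.
exists (\sum_i Ccst M (t (f i)) *: X i); apply: tangent_eq => F.
by rewrite -[LHS]/((\sum_i Ccst M (t (f i)) *: X i) F m) vfield_sumE tE.
Qed.

(** Since [S] admits at most one vector at each point, local solutions agree where they overlap, and
    no partition of unity is needed. *)
Lemma vfield_glue (S : forall p, tangent M p -> Prop) :
  (forall p t u, S p t -> S p u -> t = u) ->
  (forall p, exists U : vfield M, mnbhs M p (fun q => S q (vfield_at U q))) ->
  exists U : vfield M, forall p, S p (vfield_at U p).
Proof.
move=> uniqS exS; pose V p := projT1 (cid (exS p)).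
have VP p : mnbhs M p (fun q => S q (vfield_at (V p) q)) := projT2 (cid (exS p)).
have VE p : mnbhs M p (fun q => vfield_at (V q) q = vfield_at (V p) q).
  by apply: filterS (VP p) => q Sq; apply: uniqS Sq; exact: (mnbhs_singleton (VP q)).
have sV f : smooth_pred M (fun p => V p f p).
  apply: smooth_near_eq => p; exists (V p f); apply: filterS (VE p) => q.
  by move=> /(congr1 (fun t : tangent M q => t f)).
pose U (f : C) : C := MkCinf M _ (sV f).
have Up : vfield_pred (U : C -> (C^o)%type).
  apply/asboolP; split=> [a f g|f g]; apply: cinf_eq => p.
    by rewrite -[LHS]/(V p (Ccst M a * f + g) p) (vfieldP _).1.
  by rewrite -[LHS]/(V p (f * g) p) (vfieldP _).2.
exists (MkVfield Up) => p.
have -> : vfield_at (MkVfield Up) p = vfield_at (V p) p by exact: tangent_eq.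
exact: (mnbhs_singleton (VP p)).
Qed.

End vector_fields.

Lemma lhom_eq (A : comPzRingType) (U V : lmodType A) (f g : lhom U V) :
  (forall u, f u = g u) -> f = g.
Proof. by move=> fg; apply: val_inj; apply/funext. Qed.

(** * Duality, locality of derivations, linear vector fields *)

Section bundle_sections.
Variables (R : realType) (n r : nat) (T : Type) (M : manifold R n T).
Variables (fib : T -> lmodType R) (E : vbundle r M fib).
Local Notation TE := (Defs.total E).
Local Notation C := (Cinf M).
Local Notation pb := (pullback E).
Local Notation pt := (existT (fun m => fib m : Type)).
Local Notation ev eps m e := ((eps m : lhom _ _) e).

Lemma dsec_sumE (I : Type) (l : seq I) (eps : I -> dsec E) m :
  (\sum_(i <- l) eps i) m = \sum_(i <- l) eps i m.
Proof. by apply: (big_morph (fun x : dsec E => x m)). Qed.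

Lemma lhom_sumE (A : comPzRingType) (U V : lmodType A) (I : Type) (l : seq I)
    (f : I -> lhom U V) u :
  (\sum_(i <- l) f i) u = \sum_(i <- l) f i u.
Proof. by apply: (big_morph (fun x : lhom U V => x u)). Qed.

Lemma sec_extend m (e : fib m) : exists s : sec E, s m = e.
Proof.
have [f [X [eps [s [H _]]]]] := bundle_frame E m.
have [_ _ eE] := mnbhs_singleton H.
pose s' m' : fib m' := \sum_j ev (eps j) m e *: s j m'.
suff ss : forall eta : dsec E, smooth_pred M (fun m => ev eta m (s' m)).
  by exists (MkSec (sec_smoothP ss)); rewrite /= /s' -eE.
move=> eta; have := cinf_smooth (\sum_j Ccst M (ev (eps j) m e) * pairing eta (s j)).
congr smooth_pred; apply/funext => m'; rewrite cinf_sumE /s' linear_sum.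
by apply: eq_bigr => j _; rewrite linearZ.
Qed.

Lemma pairing_sep (eps eta : dsec E) :
  (forall s, pairing eps s = pairing eta s) -> eps = eta.
Proof.
move=> h; apply: dsecP => m; apply: lhom_eq => e; have [s <-] := sec_extend e.
by have := congr1 (fun f : C => f m) (h s).
Qed.

Lemma tangent_total_eq p (t u : tangent TE p) :
  (forall f, t (pb f) = u (pb f)) -> (forall eps, t (ell eps) = u (ell eps)) -> t = u.
Proof.
case: p t u => m e t u hf he; apply: tangent_eq => F.
have [f [X [eps [s [_ H]]]]] := bundle_frame E m.
have [Y [Z YZ]] := H e.
have [_ _ _ _ tE] := mnbhs_singleton YZ; rewrite !tE.
by congr (_ + _); apply: eq_bigr => i _; rewrite ?hf ?he.
Qed.

Lemma dsec_near_eq0 m (x y : dsec E) : mnbhs M m (fun m' => x m' = y m') ->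
  exists chi : C, chi m = 1 /\ chi *: (x - y) = 0.
Proof.
move=> xy; have [chi [chi1 chiP]] := mnbhs_bump xy; exists chi; split=> //.
apply: dsecP => m'; rewrite -[LHS]/(chi m' *: (x m' - y m')).
by have [->|/chiP ->] := eqVneq (chi m') 0; rewrite ?scale0r // subrr scaler0.
Qed.

Lemma dsec_decomp (eps : 'I_r -> dsec E) (s : 'I_r -> sec E) m (x : dsec E) :
  (forall e : fib m, e = \sum_j ev (eps j) m e *: s j m) ->
  x m = (\sum_j pairing x (s j) *: eps j) m.
Proof.
move=> eE; apply: lhom_eq => e; rewrite dsec_sumE lhom_sumE {1}[e]eE linear_sum.
by apply: eq_bigr => j _; rewrite linearZ [RHS]mulrC.
Qed.

(** A function-linear map is local, by a bump function; expanding [nu] in a dual frame then shows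
    that [B nu m] depends only on [nu m], linearly. The vector representing it is read off from the
    frame. *)
Lemma dual_representation (B : dsec E -> C) :
  (forall f x y, B (f *: x + y) = f * B x + B y) ->
  exists s : sec E, forall nu, pairing nu s = B nu.
Proof.
move=> lB; have BD x y : B (x + y) = B x + B y.
  by have := lB 1 x y; rewrite scale1r mul1r.
have B0 : B 0 = 0 by apply: (addrI (B 0)); rewrite -BD !addr0.
have BZ f x : B (f *: x) = f * B x by have := lB f x 0; rewrite !addr0 B0 addr0.
have BN x : B (- x) = - B x by apply: (addrI (B x)); rewrite -BD !subrr.
have Bloc m (x y : dsec E) : mnbhs M m (fun m' => x m' = y m') -> B x m = B y m.
  move=> xy; have [chi [chi1 E0]] := dsec_near_eq0 xy.
  have := congr1 (fun f : C => f m) (BZ chi (x - y)).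
  rewrite E0 B0 -[RHS]/(chi m * B (x - y) m) chi1 mul1r BD BN.
  by move=> /esym/subr0_eq.
have ex m : exists e : fib m, forall nu : dsec E, ev nu m e = B nu m.
  have [f [X [eps [s [H _]]]]] := bundle_frame E m.
  exists (\sum_j B (eps j) m *: s j m) => nu.
  rewrite (Bloc m nu (\sum_j pairing nu (s j) *: eps j)); last first.
    by apply: filterS H => m' [_ _ eE]; exact: dsec_decomp.
  rewrite (big_morph B BD B0) cinf_sumE linear_sum; apply: eq_bigr => j _.
  by rewrite linearZ BZ [LHS]mulrC.
pose s m := projT1 (cid (ex m)).
have sE m (nu : dsec E) : ev nu m (s m) = B nu m := projT2 (cid (ex m)) nu.
have ss (nu : dsec E) : smooth_pred M (fun m => ev nu m (s m)).
  by have := cinf_smooth (B nu); congr smooth_pred; apply/funext => m; rewrite sE.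
by exists (MkSec (sec_smoothP ss)) => nu; apply: cinf_eq => m; exact: sE.
Qed.

Lemma pairingD (x y : dsec E) s : pairing (x + y) s = pairing x s + pairing y s.
Proof. exact: cinf_eq. Qed.

Lemma pairingZ f (x : dsec E) s : pairing (f *: x) s = f * pairing x s.
Proof. exact: cinf_eq. Qed.

Lemma pairingN (x : dsec E) s : pairing (- x) s = - pairing x s.
Proof. exact: cinf_eq. Qed.

(** Replacing [nu] by [f nu] produces the term [symb d f * pairing nu s] twice with opposite signs,
    so the right-hand side is function-linear in [nu] and comes from a section. *)
Lemma der_dualP (d : der E) nu s :
  pairing nu (der_dual d s) = symb d (pairing nu s) - pairing (d nu) s.
Proof.
rewrite /der_dual.
have /choice [D DE] : forall s : sec E, exists s' : sec E, forall nu,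
    pairing nu s' = symb d (pairing nu s) - pairing (d nu) s.
  move=> s'; apply: dual_representation => f x y.
  rewrite derD der_leibniz !pairingD !pairingZ vfieldD (vfieldP _).2; ring.
have H : exists D : sec E -> sec E, forall nu s,
    pairing nu (D s) = symb d (pairing nu s) - pairing (d nu) s.
  by exists D.
exact: (theP id H).
Qed.

Lemma der0E (d : der E) : d 0 = 0.
Proof. by apply: (addrI (d 0)); rewrite -derD !addr0. Qed.

Lemma derN (d : der E) x : d (- x) = - d x.
Proof. by apply: (addrI (d x)); rewrite -derD !subrr der0E. Qed.

(** In the Leibniz rule for [chi (x - y) = 0] with [chi m = 1], the symbol term carries the factor
    [x m - y m], which is zero. *)
Lemma der_local (d : der E) m (x y : dsec E) :
  mnbhs M m (fun m' => x m' = y m') -> d x m = d y m.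
Proof.
move=> xy; have [chi [chi1 E0]] := dsec_near_eq0 xy.
have := congr1 (fun x : dsec E => x m) (der_leibniz d chi (x - y)).
rewrite E0 der0E derD derN.
rewrite -[RHS]/(chi m *: (d x m - d y m) + symb d chi m *: (x m - y m)).
rewrite (mnbhs_singleton xy) subrr scaler0 addr0 chi1 scale1r.
by move=> /esym/subr0_eq.
Qed.

Lemma der_ext (d1 d2 : der E) :
  (forall x, d1 x = d2 x) -> symb d1 = symb d2 -> d1 = d2.
Proof.
case: d1 d2 => D1 X1 l1 L1 [D2 X2 l2 L2] /= /funext D X.
by subst D2 X2; congr MkDer; exact: Prop_irrelevance.
Qed.

Lemma ell_inj : injective (@ell _ _ _ _ _ _ E).
Proof.
move=> x y xy; apply: dsecP => m; apply: lhom_eq => e.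
by have := congr1 (fun F : Cinf TE => F (pt m e)) xy.
Qed.

Lemma pullback_inj : injective pb.
Proof.
move=> f g fg; apply: cinf_eq => m.
by have := congr1 (fun F : Cinf TE => F (pt m 0)) fg.
Qed.

Lemma ellD (x y : dsec E) : ell (x + y) = ell x + ell y.
Proof. exact: cinf_eq. Qed.

Lemma ellN (x : dsec E) : ell (- x) = - ell x.
Proof. exact: cinf_eq. Qed.

Lemma ell_sum (I : Type) (l : seq I) (f : I -> C) (x : I -> dsec E) :
  ell (\sum_(i <- l) f i *: x i) = \sum_(i <- l) pb (f i) * ell (x i).
Proof.
have ell0 : ell (0 : dsec E) = 0 by exact: cinf_eq.
rewrite (big_morph (@ell _ _ _ _ _ _ E) ellD ell0).
by apply: eq_bigr => i _; exact: cinf_eq.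
Qed.

Lemma ell_near m (e : fib m) (x y : dsec E) : mnbhs M m (fun m' => x m' = y m') ->
  mnbhs TE (pt m e) (fun p => ell x p = ell y p).
Proof.
move=> xy; have N := mnbhs_pullback E (p := pt m e) xy.
by apply: filterS N => -[m' e'] /= E0; rewrite /ell_fun /= E0.
Qed.

Lemma dq_frame (f : 'I_n -> C) (X : 'I_n -> vfield M) p (t : tangent TE p) :
  (forall (t : tangent M (projT1 p)) (F : C), t F = \sum_i t (f i) * X i F (projT1 p)) ->
  dq t = \sum_i t (pb (f i)) *: vfield_at (X i) (projT1 p).
Proof. by move=> tE; apply: tangent_eq => F; rewrite tE tangent_sumE. Qed.

(** The prescribed values determine a tangent vector at each point by [tangent_total_eq], so it is
    enough to build the field locally and glue. *)
Lemma der_hat_exists (d : der E) : exists U : vfield TE,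
  (forall eps, U (ell eps) = ell (d eps)) /\ (forall f, U (pb f) = pb (symb d f)).
Proof.
pose S (p : {m : T & fib m}) (t : tangent TE p) :=
  (forall eps, t (ell eps) = ell (d eps) p) /\ (forall f, t (pb f) = pb (symb d f) p).
suff [U US] : exists U : vfield TE, forall p, S p (vfield_at U p).
  by exists U; split=> x; apply: cinf_eq => p; [exact: (US p).1|exact: (US p).2].
apply: vfield_glue => [p t u [tl tf] [ul uf]|[m0 e0]].
  by apply: tangent_total_eq => x; rewrite ?tl ?ul ?tf ?uf.
have [f [X [eps [s [H HTE]]]]] := bundle_frame E m0.
have [Y [Z YZ]] := HTE e0.
(* The coefficients are the values required on the coordinate functions of [E]. *)
pose U := \sum_i pb (symb d (f i)) *: Y i + \sum_j ell (d (eps j)) *: Z j.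
exists U.
have UE F p : U F p = \sum_i pb (symb d (f i)) p * Y i F p +
    \sum_j ell (d (eps j)) p * Z j F p.
  rewrite -[LHS]/((\sum_i pb (symb d (f i)) *: Y i) F p +
    (\sum_j ell (d (eps j)) *: Z j) F p).
  by rewrite !vfield_sumE.
have N := mnbhs_pullback E (p := pt m0 e0) (mnbhs_nbhs H).
apply: filterS2 YZ N => -[m e] [Yf Ye Zf Ze _] Hm; have [XfE tE eE] := mnbhs_singleton Hm.
have Uf i : U (pb (f i)) (pt m e) = symb d (f i) m.
  rewrite UE [X in _ + X]big1 ?addr0; last by move=> j _; rewrite Zf mulr0.
  rewrite (bigD1 i) //= Yf eqxx mulr1 big1 ?addr0 // => j ji.
  by rewrite Yf (negbTE ji) mulr0.
have Ue j : U (ell (eps j)) (pt m e) = ell (d (eps j)) (pt m e).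
  rewrite UE big1 ?add0r; last by move=> i _; rewrite Ye mulr0.
  rewrite (bigD1 j) //= Ze eqxx mulr1 big1 ?addr0 // => k kj.
  by rewrite Ze (negbTE kj) mulr0.
have Spb g : U (pb g) (pt m e) = symb d g m.
  rewrite -[LHS]/(dq (vfield_at U (pt m e)) g) (dq_frame _ tE) tangent_sumE.
  rewrite -[RHS]/(vfield_at (symb d) m g) tE.
  by apply: eq_bigr => i _; rewrite -[vfield_at U _ _]/(U (pb (f i)) (pt m e)) Uf.
split=> [x|g]; last exact: Spb.
(* From the frame to an arbitrary [x]: expand it near [m] and use the Leibniz rules of [U] and of
   [d] side by side. *)
have xE : mnbhs M m (fun m' => x m' = (\sum_j pairing x (s j) *: eps j) m').
  by apply: filterS Hm => m' [_ _ eE']; exact: dsec_decomp.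
rewrite (tangent_local _ (ell_near e xE)) ell_sum tangent_sum.
rewrite -[RHS]/(ev (d x) m e) (der_local d xE).
rewrite (big_morph d (derD d) (der0E d)) dsec_sumE lhom_sumE.
apply: eq_bigr => j _; rewrite tangentM der_leibniz.
rewrite -[vfield_at U _ (ell _)]/(U (ell (eps j)) (pt m e)) Ue.
rewrite -[vfield_at U _ (pb _)]/(U (pb (pairing x (s j))) (pt m e)) Spb.
by congr (_ + _); rewrite mulrC.
Qed.

Lemma der_hat_spec (d : der E) :
  (forall eps, der_hat d (ell eps) = ell (d eps)) /\
  (forall f, der_hat d (pb f) = pb (symb d f)).
Proof. exact: (theP 0 (der_hat_exists d)). Qed.

Lemma der_hat_uniq (d : der E) (U : vfield TE) :
  (forall eps, U (ell eps) = ell (d eps)) -> (forall f, U (pb f) = pb (symb d f)) ->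
  U = der_hat d.
Proof.
move=> Ue Uf; have [De Df] := der_hat_spec d.
apply: vfield_eq => F p.
rewrite -[LHS]/(vfield_at U p F) -[RHS]/(vfield_at (der_hat d) p F).
congr (tangent_fun _ _); apply: tangent_total_eq => x /=.
  by rewrite Uf Df.
by rewrite Ue De.
Qed.

(** The pulled back functions recover the symbol, even in rank 0 where the operator alone does not
    determine it. *)
Lemma der_hat_inj : injective (@der_hat _ _ _ _ _ _ E).
Proof.
move=> d1 d2 d12; have [e1 f1] := der_hat_spec d1; have [e2 f2] := der_hat_spec d2.
apply: der_ext => [x|]; first by apply: ell_inj; rewrite -e1 -e2 d12.
by apply: val_inj; apply/funext => f; apply: pullback_inj; rewrite -f1 -f2 d12.
Qed.

Lemma der_hat_comm (d1 d2 : der E) :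
  vbracket (der_hat d1) (der_hat d2) = der_hat (dcomm d1 d2).
Proof.
have [e1 f1] := der_hat_spec d1; have [e2 f2] := der_hat_spec d2.
apply: der_hat_uniq => x /=.
  by rewrite e2 e1 e1 e2 -ellN -ellD.
by rewrite f2 f1 f1 f2; exact: cinf_eq.
Qed.

End bundle_sections.

(** * The omni-Lie algebroid *)

Lemma lhomDE (A : comPzRingType) (U V : lmodType A) (f g : lhom U V) u :
  (f + g) u = f u + g u.
Proof. by []. Qed.

Lemma lhomNE (A : comPzRingType) (U V : lmodType A) (f : lhom U V) u :
  (- f) u = - f u.
Proof. by []. Qed.

(** * Cartan calculus of one-forms *)

Section one_forms.
Variables (R : realType) (n : nat) (T : Type) (M : manifold R n T).

Lemma cinfDE (f g : Cinf M) m : (f + g) m = f m + g m.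
Proof. by []. Qed.

Lemma cinfNE (f : Cinf M) m : (- f) m = - f m.
Proof. by []. Qed.

Lemma lieformE (X Y : vfield M) (a : oneform M) :
  lieform X a Y = X (a Y) - a (vbracket X Y).
Proof. by []. Qed.

Lemma dformE (f : Cinf M) (X : vfield M) : dform f X = X f.
Proof. by []. Qed.

Lemma lieform_dform (X : vfield M) f : lieform X (dform f) = dform (X f).
Proof.
apply: lhom_eq => Y; rewrite -[LHS]/(X (Y f) - (X (Y f) - Y (X f))).
by rewrite opprB addrC subrK.
Qed.

Lemma lieformD (X : vfield M) (a b : oneform M) : lieform X (a + b) = lieform X a + lieform X b.
Proof.
apply: lhom_eq => Y.
rewrite -[LHS]/(X (a Y + b Y) - (a (vbracket X Y) + b (vbracket X Y))).
rewrite -[RHS]/(X (a Y) - a (vbracket X Y) + (X (b Y) - b (vbracket X Y))).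
by rewrite vfieldD opprD addrACA.
Qed.

Lemma cartan (X : vfield M) (a : oneform M) : iextd X a = lieform X a - dform (a X).
Proof. by apply: lhom_eq => Y; exact: addrAC. Qed.

Lemma dformD (f g : Cinf M) : dform (f + g) = dform f + dform g.
Proof. by apply: lhom_eq => Y; exact: vfieldD. Qed.

End one_forms.

Section omni_lie.
Variables (R : realType) (n r : nat) (T : Type) (M : manifold R n T).
Variables (fib : T -> lmodType R) (E : vbundle r M fib).
Local Notation TE := (Defs.total E).
Local Notation C := (Cinf M).
Local Notation pb := (pullback E).
Local Notation pt := (existT (fun m => fib m : Type)).
Local Notation ev eps m e := ((eps m : lhom _ _) e).

(** Tensoriality, as in [dual_representation]: locality by a bump function, then
    [t |-> sum_i t(f_i) Psi(X_i)] in a frame of the tangent bundle. *)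
Lemma hom_representation (Psi : vfield M -> dsec E) :
  (forall f X Y, Psi (f *: X + Y) = f *: Psi X + Psi Y) ->
  exists psi : homsec E, forall X, happ psi X = Psi X.
Proof.
move=> lP; have PD X Y : Psi (X + Y) = Psi X + Psi Y.
  by have := lP 1 X Y; rewrite !scale1r.
have P0 : Psi 0 = 0 by apply: (addrI (Psi 0)); rewrite -PD !addr0.
have PZ f X : Psi (f *: X) = f *: Psi X by have := lP f X 0; rewrite !addr0 P0 addr0.
have PN X : Psi (- X) = - Psi X by apply: (addrI (Psi X)); rewrite -PD !subrr.
have Ploc m (X Y : vfield M) :
    mnbhs M m (fun m' => vfield_at X m' = vfield_at Y m') -> Psi X m = Psi Y m.
  move=> XY; have [chi [chi1 chiP]] := mnbhs_bump XY.
  have E0 : chi *: (X - Y) = 0.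
    apply: vfield_eq => f m'; rewrite -[LHS]/(chi m' * (X f m' - Y f m')).
    have [->|/chiP /(congr1 (fun t : tangent M m' => t f)) /= ->] := eqVneq (chi m') 0.
      by rewrite mul0r.
    by rewrite subrr mulr0.
  have := congr1 (fun x : dsec E => x m) (PZ chi (X - Y)).
  rewrite E0 P0 PD PN -[RHS]/(chi m *: (Psi X m - Psi Y m)) chi1 scale1r.
  by move=> /esym/subr0_eq.
have ex m : exists L : lhom (tangent M m) (dualfib fib m),
    forall X, L (vfield_at X m) = Psi X m.
  have [f [X [eps [s [H _]]]]] := bundle_frame E m.
  have lL : lin_pred (fun t : tangent M m => \sum_i t (f i) *: Psi (X i) m).
    apply/asboolP => a t u; rewrite scaler_sumr -big_split; apply: eq_bigr => i _.
    by rewrite -[(a *: t + u) _]/(a * t (f i) + u (f i)) scalerDl scalerA.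
  exists (MkLhom lL) => Z /=.
  rewrite (Ploc m Z (\sum_i Z (f i) *: X i)); last first.
    apply: filterS H => m' [_ tE _]; apply: tangent_eq => F.
    by rewrite tE -[RHS]/((\sum_i Z (f i) *: X i) F m') vfield_sumE.
  rewrite (big_morph Psi PD P0) dsec_sumE; apply: eq_bigr => i _.
  by rewrite PZ.
pose psi m := projT1 (cid (ex m)).
have psiE m X : psi m (vfield_at X m) = Psi X m := projT2 (cid (ex m)) X.
have spsi : hom_fun_smooth E psi.
  move=> X; have := dsec_smooth (Psi X); congr smooth_pred; apply/funext => -[m e].
  by rewrite /ell_fun /= psiE.
by exists (MkHomsec spsi) => X; apply: dsecP => m; exact: psiE.
Qed.

Lemma happ_linear (phi : homsec E) f (X Y : vfield M) :
  happ phi (f *: X + Y) = f *: happ phi X + happ phi Y.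
Proof.
apply: dsecP => m /=.
have -> : vfield_at (f *: X + Y) m = f m *: vfield_at X m + vfield_at Y m.
  exact: tangent_eq.
by rewrite linearP.
Qed.

Lemma homsec_eq (phi psi : homsec E) :
  (forall X, happ phi X = happ psi X) -> phi = psi.
Proof.
move=> h; apply: homsecP => m; apply: lhom_eq => t.
have [X <-] := tangent_extend t.
by have := congr1 (fun x : dsec E => x m) (h X).
Qed.

Lemma hdual_secE (phi : homsec E) s X : hdual_sec phi s X = pairing (happ phi X) s.
Proof. exact: cinf_eq. Qed.

(** Evaluate the defining identity on a field [Y] and insert the dual derivation: the two terms
    [symb d (pairing (happ phi Y) s)] cancel, and separation by sections [s] leaves this formula. *)
Lemma happ_lie_hom (d : der E) phi X :
  happ (lie_hom d phi) X = d (happ phi X) - happ phi (vbracket (symb d) X).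
Proof.
pose Psi X := d (happ phi X) - happ phi (vbracket (symb d) X).
have spec (psi : homsec E) : (forall s, hdual_sec psi s =
    lieform (symb d) (hdual_sec phi s) - hdual_sec phi (der_dual d s)) <->
    forall X, happ psi X = Psi X.
  have rhs s Y : (lieform (symb d) (hdual_sec phi s) - hdual_sec phi (der_dual d s)) Y =
      pairing (Psi Y) s.
    rewrite -[LHS]/(symb d (hdual_sec phi s Y) -
      hdual_sec phi s (vbracket (symb d) Y) - hdual_sec phi (der_dual d s) Y).
    rewrite !hdual_secE der_dualP /Psi pairingD pairingN opprB addrC addrA subrK.
    by [].
  split=> [h Y|h s].
    by apply: pairing_sep => s; rewrite -rhs -h hdual_secE.
  by apply: lhom_eq => Y; rewrite rhs -h hdual_secE.
suff [psi psiE] : exists psi : homsec E, forall X, happ psi X = Psi X.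
  have ex : exists psi : homsec E, forall s, hdual_sec psi s =
      lieform (symb d) (hdual_sec phi s) - hdual_sec phi (der_dual d s).
    by exists psi; exact: (iffRL (spec _) psiE).
  exact: (iffLR (spec _) (theP 0 ex) X).
apply: hom_representation.
(* The derivation and the bracket each contribute [symb d f *: happ phi Y], with opposite signs. *)
move=> f Y Z; rewrite /Psi vbracketZDr !happ_linear derD der_leibniz.
rewrite [_ + (_ + happ phi _)]addrCA scalerBr.
rewrite [_ *: d _ + _]addrC -[_ + _ *: d _ + _]addrA.
by rewrite opprD addrACA subrr add0r opprD addrACA.
Qed.

Lemma hdual_dq (f : 'I_n -> C) (X : 'I_n -> vfield M) (phi : homsec E) m (e : fib m)
    (t : tangent TE (pt m e)) :
  (forall (t : tangent M m) (F : C), t F = \sum_i t (f i) * X i F m) ->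
  (hdual phi e : lhom _ _) (dq t) = \sum_i t (pb (f i)) * ell (happ phi (X i)) (pt m e).
Proof.
move=> tE; rewrite (dq_frame (f := f) (X := X)) // linear_sum.
by apply: eq_bigr => i _; rewrite linearZ.
Qed.

(** What has to be shown is that the pointwise formula is smooth along [U]; locally it is the finite
    sum of [hdual_dq]. *)
Lemma tildeE (phi : homsec E) (U : vfield TE) m (e : fib m) :
  tilde phi U (pt m e) = (hdual phi e : lhom _ _) (dq (vfield_at U (pt m e))).
Proof.
suff ex : exists w : oneform TE, forall (U : vfield TE) m (e : fib m),
    w U (pt m e) = (hdual phi e : lhom _ _) (dq (vfield_at U (pt m e))).
  exact: (theP 0 ex).
pose h (U : vfield TE) (p : {m : T & fib m}) : R :=
  (hdual phi (projT2 p) : lhom _ _) (dq (vfield_at U p)).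
have sh U' : smooth_pred TE (h U').
  apply: smooth_near_eq => -[m0 e0].
  have [f [X [eps [s [H _]]]]] := bundle_frame E m0.
  exists (\sum_i U' (pb (f i)) * ell (happ phi (X i))).
  have N := mnbhs_pullback E (p := pt m0 e0) H.
  apply: filterS N => -[m' e'] [_ tE _].
  by rewrite /h (hdual_dq (f := f) (X := X)) // cinf_sumE.
have lh : lin_pred (fun U => MkCinf TE _ (sh U) : (Cinf TE)^o%type).
  apply/asboolP => F U' V; apply: cinf_eq => p.
  rewrite -[LHS]/(h (F *: U' + V) p) -[RHS]/(F p * h U' p + h V p) /h.
  have -> : dq (vfield_at (F *: U' + V) p) =
      F p *: dq (vfield_at U' p) + dq (vfield_at V p) by exact: tangent_eq.
  by rewrite linearP.
by exists (MkLhom lh).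
Qed.

#[local] Opaque tilde lie_hom der_hat.

Lemma tildeD (phi psi : homsec E) : tilde (phi + psi) = tilde phi + tilde psi.
Proof.
apply: lhom_eq => U; apply: cinf_eq => -[m e].
by rewrite lhomDE cinfDE !tildeE.
Qed.

Lemma tildeN (phi : homsec E) : tilde (- phi) = - tilde phi.
Proof.
apply: lhom_eq => U; apply: cinf_eq => -[m e].
by rewrite lhomNE cinfNE !tildeE.
Qed.

(** A linear vector field projects to its symbol. *)
Lemma tilde_der_hat (phi : homsec E) (d : der E) :
  tilde phi (der_hat d) = ell (happ phi (symb d)).
Proof.
apply: cinf_eq => -[m e]; rewrite tildeE.
have [_ df] := der_hat_spec d.
have -> : dq (vfield_at (der_hat d) (pt m e)) = vfield_at (symb d) m.
  apply: tangent_eq => f; rewrite -[LHS]/(der_hat d (pb f) (pt m e)) df.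
  by [].
by [].
Qed.

Lemma tilde_lie (d : der E) (phi : homsec E) :
  lieform (der_hat d) (tilde phi) = tilde (lie_hom d phi).
Proof.
apply: lhom_eq => U; apply: cinf_eq => -[m e].
have [f [X [eps [s [H _]]]]] := bundle_frame E m.
have [XfE tE _] := mnbhs_singleton H.
have [de df] := der_hat_spec d; set D := der_hat d; set V := symb d.
pose a i := happ phi (X i).
rewrite lieformE cinfDE cinfNE.
have N := mnbhs_pullback E (p := pt m e) H.
(* [D] differentiates, so the frame expression is needed on a neighbourhood; the other two terms are
   expanded at the point only. *)
have -> : D (tilde phi U) (pt m e) = D (\sum_i U (pb (f i)) * ell (a i)) (pt m e).
  apply: vfield_local; apply: filterS N => -[m' e'] [_ tE' _].
  by rewrite tildeE (hdual_dq (f := f) (X := X)) // cinf_sumE.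
rewrite !tildeE !(hdual_dq (f := f) (X := X)) //.
rewrite -[D _ _]/(vfield_at D (pt m e) (\sum_i U (pb (f i)) * ell (a i))) tangent_sum.
(* [X i (f j)] is a Kronecker delta on a neighbourhood, hence locally constant. *)
have Xc i j : V (X i (f j)) m = 0.
  rewrite (vfield_local _ (g := Ccst M (i == j)%:R)); last first.
    by apply: filterS H => m' [XfE' _ _]; rewrite XfE'.
  exact: (tangent_cst (vfield_at V m)).
have brE i : ell (happ phi (vbracket V (X i))) (pt m e) =
    - \sum_j X i (V (f j)) m * ell (a j) (pt m e).
  rewrite -[LHS]/((hdual phi e : lhom _ _) (vfield_at (vbracket V (X i)) m)).
  have -> : vfield_at (vbracket V (X i)) m = - \sum_j X i (V (f j)) m *: vfield_at (X j) m.
    apply: tangent_eq => F; rewrite tE -[RHS]/(- (\sum_j X i (V (f j)) m *: vfield_at (X j) m) F).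
    rewrite tangent_sumE -sumrN; apply: eq_bigr => j _.
    rewrite -[vfield_at _ _ _]/(V (X i (f j)) m - X i (V (f j)) m) Xc sub0r.
    by rewrite mulNr.
  rewrite linearN linear_sum; congr (- _); apply: eq_bigr => j _.
  by rewrite linearZ.
have UV j : U (pb (V (f j))) (pt m e) = \sum_i U (pb (f i)) (pt m e) * X i (V (f j)) m.
  by rewrite -[LHS]/(dq (vfield_at U (pt m e)) (V (f j))) 
    (dq_frame (f := f) (X := X)) // tangent_sumE.
(* The terms [D (U (pb (f i)))] cancel against the first half of the bracket [[D, U]], leaving
   [U (D (pb (f i)))]. *)
transitivity (\sum_i (U (pb (f i)) (pt m e) * ell (d (a i)) (pt m e) +
    U (pb (V (f i))) (pt m e) * ell (a i) (pt m e))).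
  rewrite -sumrB; apply: eq_bigr => i _; rewrite tangentM.
  rewrite -[vfield_at D _ (ell _)]/(D (ell (a i)) (pt m e)) de.
  rewrite -[vfield_at D _ (U _)]/(D (U (pb (f i))) (pt m e)).
  rewrite -[vfield_at _ _ _]/(D (U (pb (f i))) (pt m e) - U (D (pb (f i))) (pt m e)) df.
  ring.
transitivity (\sum_i U (pb (f i)) (pt m e) *
    (ell (d (a i)) (pt m e) - ell (happ phi (vbracket V (X i))) (pt m e))); last first.
  by apply: eq_bigr => i _; rewrite happ_lie_hom ellD ellN.
(* The bracket terms give a double sum over [i] and [j]; summed over [i] first, it is the expansion
   [UV] of [U (pb (V (f j)))]. *)
under [RHS]eq_bigr do rewrite brE opprK mulrDr mulr_sumr.
rewrite !big_split /=; congr (_ + _); rewrite exchange_big /=; apply: eq_bigr => j _.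
by rewrite UV mulr_suml; apply: eq_bigr => i _; rewrite mulrA.
Qed.

(** * Jets and the injectivity of [Theta] *)

Lemma j1D (x y : dsec E) : j1 (x + y) = j1 x + j1 y.
Proof. by apply: jetP => m; exact: j1_funD. Qed.

Lemma jiotaD (x y : homsec E) : jiota (x + y) = jiota x + jiota y.
Proof. by apply: jetP => m; exact: iota_funD. Qed.

Lemma jiotaN (x : homsec E) : jiota (- x) = - jiota x.
Proof.
apply: (addrI (jiota x)); rewrite -jiotaD !subrr.
by apply: jetP => m; exact: iota_fun0.
Qed.

Lemma jiota_inj : injective (@jiota _ _ _ _ _ _ E).
Proof.
move=> phi psi h; apply: homsec_eq => X; apply: pairing_sep => s; apply: cinf_eq => m.
by have := congr1 (fun mu : jet E => (mu m).2 (vfield_at X m) s) h.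
Qed.

Lemma jet_decomp (mu : jet E) : exists eps phi, mu = j1 eps + jiota phi.
Proof.
by have [eps [phi h]] := jet_smoothP mu; exists eps, phi; apply: jetP.
Qed.

Lemma jet_prE (eps : dsec E) phi : jet_pr (j1 eps + jiota phi) = eps.
Proof.
have pr1 m : ((j1 eps + jiota phi : jet E) m).1 = eps m by exact: addr0.
apply: the_eq => [m|x xE]; first by rewrite pr1.
by apply: dsecP => m; rewrite xE pr1.
Qed.

Lemma jet_homE (eps : dsec E) phi : jet_hom (j1 eps + jiota phi) = phi.
Proof.
rewrite /jet_hom jet_prE; apply: the_eq; first by rewrite addrAC subrr add0r.
by move=> psi h; apply: jiota_inj; rewrite h addrAC subrr add0r.
Qed.

Lemma lie_jetE (d : der E) eps phi :
  lie_jet d (j1 eps + jiota phi) = j1 (d eps) + jiota (lie_hom d phi).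
Proof. by rewrite /lie_jet jet_prE jet_homE. Qed.

Lemma der_jetE (d : der E) eps phi :
  der_jet d (j1 eps + jiota phi) = d eps + happ phi (symb d).
Proof. by rewrite /der_jet jet_prE jet_homE. Qed.

Lemma ThetaE (d : der E) eps phi :
  Theta (d, j1 eps + jiota phi) = (der_hat d, dform (ell eps) + tilde phi).
Proof. by rewrite /Theta /= jet_prE jet_homE. Qed.

Lemma id_der_lin (a : R) (x y : dsec E) :
  Ccst M a *: x + y = Ccst M a *: x + y.
Proof. by []. Qed.

Lemma id_der_leibniz (f : C) (x : dsec E) : f *: x = f *: x + (0 : vfield M) f *: x.
Proof. by rewrite (_ : (0 : vfield M) f = 0) // scale0r addr0. Qed.

(* The associated linear vector field is the Euler vector field of [E]: it
   recovers [ell eps] from [d (ell eps)] and annihilates every [tilde phi]. *)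
Definition id_der : der E := @MkDer _ _ _ _ _ _ E id 0 id_der_lin id_der_leibniz.

(** Surjectivity of the differential of the projection, by a combination of the base fields [Y i]
    with constant coefficients. It makes [phi] recoverable from [tilde phi]. *)
Lemma tangent_lift m (e : fib m) (t : tangent M m) :
  exists U : vfield TE, dq (vfield_at U (pt m e)) = t.
Proof.
have [f [X [eps [s [H HTE]]]]] := bundle_frame E m.
have [Y [Z YZ]] := HTE e.
have [_ tE _] := mnbhs_singleton H; have [Yf _ _ _ _] := mnbhs_singleton YZ.
exists (\sum_i Ccst TE (t (f i)) *: Y i).
rewrite (dq_frame (f := f) (X := X)) //; apply: tangent_eq => F.
rewrite tangent_sumE [RHS]tE; apply: eq_bigr => i _.
rewrite -[vfield_at _ _ _]/((\sum_i Ccst TE (t (f i)) *: Y i) (pb (f i)) (pt m e)).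
rewrite vfield_sumE (bigD1 i) //= Yf eqxx mulr1 big1 ?addr0 // => j ji.
by rewrite Yf (negbTE ji) mulr0.
Qed.

Lemma Theta_inj : injective (@Theta _ _ _ _ _ _ E).
Proof.
move=> [d1 mu1] [d2 mu2].
have [eps1 [phi1 ->]] := jet_decomp mu1; have [eps2 [phi2 ->]] := jet_decomp mu2.
rewrite !ThetaE => h0; have -> : d1 = d2 by apply: der_hat_inj; exact: (congr1 fst h0).
have {h0} h : dform (ell eps1) + tilde phi1 = dform (ell eps2) + tilde phi2.
  exact: (congr1 snd h0).
have eps12 : eps1 = eps2.
  have euler eps phi : (dform (ell eps) + tilde phi) (der_hat id_der) = ell eps.
    rewrite lhomDE dformE (der_hat_spec id_der).1 tilde_der_hat -ellD; congr ell.
    apply: dsecP => m /=; rewrite (_ : vfield_at _ _ = 0) ?linear0 ?addr0 //.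
    exact: tangent_eq.
  by apply: ell_inj; rewrite -(euler eps1 phi1) h euler.
rewrite eps12 in h *; congr (_, _ + jiota _); move/addrI in h.
apply: homsecP => m; apply: lhom_eq => t; apply: lhom_eq => e.
(* With equal [eps] the forms [tilde phi1] and [tilde phi2] agree; at [e], on a lift of [t], they
   read off [phi1] and [phi2]. *)
have [U Ut] := tangent_lift e t.
have := congr1 (fun F : Cinf TE => F (pt m e)) (congr1 (fun w : oneform TE => w U) h).
by rewrite !tildeE Ut.
Qed.

(** * Comparison of the two structures *)

Lemma omni_bracketE (d1 d2 : der E) eps1 eps2 phi1 phi2 :
  omni_bracket (d1, j1 eps1 + jiota phi1) (d2, j1 eps2 + jiota phi2) =
  (dcomm d1 d2, j1 (d1 eps2 + happ phi1 (symb d2)) +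
                jiota (lie_hom d1 phi2 - lie_hom d2 phi1)).
Proof.
rewrite /omni_bracket /= !lie_jetE der_jetE !j1D jiotaD jiotaN; congr (_, _).
(* The jet of [d2 eps1] occurs in the second Lie derivative and in the last summand, with opposite
   signs. *)
rewrite -[LHS]addrA [- _ + _]addrC (addrC (j1 (d2 eps1)) (j1 _)) addrKA.
by rewrite [LHS]addrACA.
Qed.

Lemma Theta_bracket (a b : der E * jet E) :
  Theta (omni_bracket a b) = courant_dorfman (Theta a) (Theta b).
Proof.
case: a b => [d1 mu1] [d2 mu2].
have [eps1 [phi1 ->]] := jet_decomp mu1; have [eps2 [phi2 ->]] := jet_decomp mu2.
rewrite omni_bracketE !ThetaE /courant_dorfman /= der_hat_comm; congr (_, _).
(* The exact term of Cartan's formula is the differential of [ell (d2 eps1 + happ phi1 (symb d2))];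
   its first part cancels as in [omni_bracketE], its second is the remaining jet term. *)
rewrite cartan !lieformD !lieform_dform !tilde_lie.
rewrite !(der_hat_spec _).1.
rewrite lhomDE dformE (der_hat_spec _).1 tilde_der_hat !ellD !dformD tildeD tildeN.
by rewrite [in RHS](addrC (dform (ell (d2 eps1)))) addrKA opprB [RHS]addrACA.
Qed.

Lemma courant_pairing_Theta (a b : der E * jet E) :
  ell (omni_pairing a b) = courant_pairing (Theta a) (Theta b).
Proof.
case: a b => [d1 mu1] [d2 mu2].
have [eps1 [phi1 ->]] := jet_decomp mu1; have [eps2 [phi2 ->]] := jet_decomp mu2.
rewrite -[omni_pairing _ _]/(der_jet d1 (j1 eps2 + jiota phi2) +
  der_jet d2 (j1 eps1 + jiota phi1)) !der_jetE !ThetaE.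
rewrite -[RHS]/((dform (ell eps1) + tilde phi1) (der_hat d2) +
  (dform (ell eps2) + tilde phi2) (der_hat d1)) !lhomDE !dformE.
by rewrite !(der_hat_spec _).1 !tilde_der_hat !ellD addrC.
Qed.

Lemma induced_bracketE (a b : der E * jet E) : induced_bracket a b = omni_bracket a b.
Proof.
apply: the_eq; first exact: Theta_bracket.
by move=> c cE; apply: Theta_inj; rewrite cE Theta_bracket.
Qed.

Lemma induced_pairingE (a b : der E * jet E) : induced_pairing a b = omni_pairing a b.
Proof.
apply: the_eq; first exact: courant_pairing_Theta.
by move=> c cE; apply: ell_inj; rewrite cE courant_pairing_Theta.
Qed.

Lemma induced_derE (a : der E * jet E) : induced_der a = a.1.
Proof. by apply: the_eq => // d; exact: der_hat_inj. Qed.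

End omni_lie.

Theorem corollary3p5 (R : realType) (n r : nat) (T : Type)
    (M : manifold R n T) (fib : T -> lmodType R) (E : vbundle r M fib) :
  (forall (d1 d2 : der E) (mu1 mu2 : jet E)
      (eps1 eps2 : dsec E) (phi1 phi2 : homsec E),
    mu1 = j1 eps1 + jiota phi1 -> mu2 = j1 eps2 + jiota phi2 ->
    [/\ induced_bracket (d1, mu1) (d2, mu2) =
          (dcomm d1 d2,
           lie_jet d1 mu2 - lie_jet d2 mu1 + j1 (der_jet d2 mu1)),
        lie_jet d1 mu2 = j1 (d1 eps2) + jiota (lie_hom d1 phi2),
        lie_jet d2 mu1 = j1 (d2 eps1) + jiota (lie_hom d2 phi1) &
        der_jet d2 mu1 = d2 eps1 + happ phi1 (symb d2)]) /\
  induced_structure E = omni_Lie E.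
Proof.
split=> [d1 d2 mu1 mu2 eps1 eps2 phi1 phi2 -> ->|].
  rewrite induced_bracketE !lie_jetE der_jetE; split=> //.
  by rewrite /omni_bracket /= !lie_jetE der_jetE.
rewrite /induced_structure /omni_Lie; congr CourantStructure.
- by apply/funext => a; rewrite induced_derE.
- by apply/funext => a; rewrite induced_derE.
- by apply/funext => a; apply/funext => b; exact: induced_pairingE.
- by apply/funext => a; apply/funext => b; exact: induced_bracketE.
Qed.
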